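(* The $sl_2$-invariant R-matrix of spin $s=3$ $$R(\lambda)=P^6+\frac{1+\lambda}{1-\lambda}P^5+P^4+\frac{4+\lambda}{4-\lambda}P^3+P^2+\frac{1+\lambda}{1-\lambda}P^1+\frac{1+\lambda}{1-\lambda}\,\frac{6+\lambda}{6-\lambda}P^0$$ has no regular $U_q(sl_2)$-invariant counterpart; that is, there exist no regular $U_q(sl_2)$-invariant R-matrices of spin $3$ (for generic $q$) whose $q\to1$ limit coincides with $R(\lambda)$.
   Context: Fix $q\in\mathbb C$ and a value of $\log q$; put $q^t=e^{t\log q}$, $[t]_q=(q^t-q^{-t})/(q-q^{-1})$ ($[t]_1=t$). ''Generic'' means $q\neq 0,\infty$ and $q$ is not a root of unity. $U_q(sl_2)$ is the unital associative $\mathbb C$-algebra with generators $S^\pm,S^z$, relations $[S^+,S^-]=[2S^z]_q$, $[S^z,S^\pm]=\pm S^\pm$, and co-multiplication $\Delta(S^\pm)=S^\pm\otimes q^{-S^z}+q^{S^z}\otimes S^\pm$, $\Delta(S^z)=S^z\otimes e+e\otimes S^z$ ($q=1$ being the undeformed $sl_2$). $V_s$ is its irreducible highest weight representation of spin $s\in\frac12\mathbb Z_{\ge0}$, of dimension $2s+1$, with basis $|k\rangle$, $k=-s,\dots,s$, $S^z|k\rangle=k|k\rangle$. Under $\Delta$, $V_s^{\otimes 2}=\bigoplus_{j=0}^{2s}V_j$; $P^j$ is the projector onto the component $V_j$ along the other components; $\mathbb E$ is the identity operator. A $U_q(sl_2)$-invariant $R(\lambda)\in\mathrm{End}\,V_s^{\otimes2}$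 has the form $R(\lambda)=\sum_{j=0}^{2s}r_j(\lambda)P^j$ with scalar functions $r_j$, assumed analytic in a neighbourhood of $\lambda=0$. It is regular if $R(0)=\mathbb E$. The Yang–Baxter equation is $$R_{12}(\lambda)R_{23}(\lambda+\mu)R_{12}(\mu)=R_{23}(\mu)R_{12}(\lambda+\mu)R_{23}(\lambda)$$ on $V_s^{\otimes3}$, the lower indices specifying the tensor factors on which $R$ acts; its solutions are called R-matrices (of spin $s$), always normalized by $r_{2s}(\lambda)=1$. ''The $q\to1$ limit of regular $U_q(sl_2)$-invariant R-matrices coincides with $R(\lambda)$'' refers to a family of such R-matrices $R^{(q)}(\lambda)=\sum_j r^{(q)}_j(\lambda)P^j$, $q$ generic near $1$, with $r_j^{(q)}\to r_j$ near $\lambda=0$ (as analytic functions) as $q\to1$, where the $r_j$ are the coefficients of $R(\lambda)$. *)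

(* Defs.v *)
From HB Require Import structures.
From mathcomp Require Import all_boot all_order all_algebra.
From mathcomp Require Import complex mxtens.
From mathcomp Require Import all_classical all_reals all_analysis.

Set Implicit Arguments.
Unset Strict Implicit.
Unset Printing Implicit Defensive.

Import Order.TTheory GRing.Theory Num.Theory.
Import numFieldNormedType.Exports.

Local Open Scope classical_set_scope.
Local Open Scope complex_scope.
Local Open Scope ring_scope.

(* The complex numbers. The ascription to [numClosedFieldType] is what gives
   them the topology of [numFieldNormedType]. *)
Definition Cplx (R : realType) : numClosedFieldType := R[i].

Definition cexp (R : realType) (z : Cplx R) : Cplx R :=
  (expR (complex.Re z) * cos (complex.Im z))
    +i* (expR (complex.Re z) * sin (complex.Im z)).

Section QuantumSl2.
Variables (R : realType).
Local Notation C := (Cplx R).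

Definition generic (q : C) : Prop :=
  q != 0 /\ forall n : nat, (0 < n)%N -> q ^+ n != 1.

(* The parameter q enters through the chosen value [l] of log q. *)
Variable l : C.

Definition qpow (t : C) : C := cexp (t * l).

Definition qnum (t : C) : C :=
  let q := cexp l in
  if q == 1 then t else (qpow t - qpow (- t)) / (q - q^-1).

(* The spin is s = n/2, so that V_s has dimension n.+1. Matrices act on column
   vectors; the basis vector of index i : 'I_n.+1 is |k> with k = i - n/2. *)
Variable n : nat.

Definition spin : C := n%:R / 2%:R.
Definition wt (i : 'I_n.+1) : C := (i : nat)%:R - spin.

Definition Sz : 'M[C]_n.+1 := diag_mx (\row_i wt i).

(* q^{a S^z} *)
Definition qSz (a : C) : 'M[C]_n.+1 := diag_mx (\row_i qpow (a * wt i)).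

(* S^z determines S^+ and S^- up to rescaling the basis vectors; here
   S^+|k> = [s - k]_q |k+1> and S^-|k> = [s + k]_q |k-1>. *)
Definition Sp : 'M[C]_n.+1 :=
  \matrix_(i, k) if i == k.+1 :> nat then qnum (spin - wt k) else 0.
Definition Sm : 'M[C]_n.+1 :=
  \matrix_(i, k) if i.+1 == k :> nat then qnum (spin + wt k) else 0.

Definition coSp : 'M[C]_(n.+1 * n.+1) := Sp *t qSz (-1) + qSz 1 *t Sp.
Definition coSm : 'M[C]_(n.+1 * n.+1) := Sm *t qSz (-1) + qSz 1 *t Sm.
Definition coSz : 'M[C]_(n.+1 * n.+1) := Sz *t 1%:M + 1%:M *t Sz.

(* Subspaces of V_s (x) V_s are row spaces, as in [mxalgebra]; the
   transpositions turn the action on columns into an action on rows. *)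

(* The highest weight vectors of weight j: killed by S^+, with S^z = j. *)
Definition hwspace (j : nat) : 'M[C]_(n.+1 * n.+1) :=
  (kermx coSp^T :&: eigenspace coSz^T j%:R)%MS.

(* The component V_j: the submodule generated by the highest weight vectors of
   weight j, spanned by their images under (S^-)^m for 0 <= m <= 2j. *)
Definition Vcomp (j : nat) : 'M[C]_(n.+1 * n.+1) :=
  (\sum_(m < (2 * j).+1) hwspace j *m (coSm^T ^+ m))%MS.

Definition Pproj (j : 'I_n.+1) : 'M[C]_(n.+1 * n.+1) :=
  (proj_mx (Vcomp j) (\sum_(i < n.+1 | i != j) Vcomp i)%MS)^T.

Definition Rop (r : 'I_n.+1 -> C -> C) (x : C) : 'M[C]_(n.+1 * n.+1) :=
  \sum_(j < n.+1) r j x *: Pproj j.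

Definition leg12 (A : 'M[C]_(n.+1 * n.+1)) : 'M[C]_(n.+1 * n.+1 * n.+1) :=
  A *t 1%:M.
Definition leg23 (A : 'M[C]_(n.+1 * n.+1)) : 'M[C]_(n.+1 * n.+1 * n.+1) :=
  castmx (mulnA n.+1 n.+1 n.+1, mulnA n.+1 n.+1 n.+1) (1%:M *t A).

Definition yang_baxter_at (A : C -> 'M[C]_(n.+1 * n.+1)) (x y : C) : Prop :=
  leg12 (A x) *m leg23 (A (x + y)) *m leg12 (A y) =
  leg23 (A y) *m leg12 (A (x + y)) *m leg23 (A x).

Definition analytic_on_disc (rho : C) (f : C -> C) : Prop :=
  exists a : nat -> C, forall x : C, `|x| < rho ->
    series (fun k : nat => a k * x ^+ k) @ \oo --> f x.

Definition analytic_near0 (f : C -> C) : Prop :=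
  exists2 rho : C, 0 < rho & analytic_on_disc rho f.

(* As the r_j are only germs of analytic functions at 0, the normalization and
   the Yang-Baxter equation are required for parameters near 0. *)
Definition is_regular_Rmatrix (r : 'I_n.+1 -> C -> C) : Prop :=
  [/\ forall j, analytic_near0 (r j),
      \forall x \near (0 : C), r ord_max x = 1,
      Rop r 0 = 1%:M
    & \forall x \near (0 : C) & y \near (0 : C), yang_baxter_at (Rop r) x y].

End QuantumSl2.

(* Convergence of analytic functions near 0 along a filter F: on some common
   disc they are eventually analytic and converge uniformly. *)
Definition cvg_analytic_near0 (R : realType) (F : set_system (Cplx R))
    (f : Cplx R -> Cplx R -> Cplx R) (g : Cplx R -> Cplx R) : Prop :=
  exists2 rho : Cplx R, 0 < rho &
    (\forall q \near F, analytic_on_disc rho (f q)) /\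
    {uniform [set x : Cplx R | `|x| < rho], f q @[q --> F] --> g}.

Definition r_spin3 (R : realType) (j : 'I_7) (x : Cplx R) : Cplx R :=
  match nat_of_ord j with
  | 0 => (1 + x) / (1 - x) * ((6%:R + x) / (6%:R - x))
  | 1 => (1 + x) / (1 - x)
  | 3 => (4%:R + x) / (4%:R - x)
  | 5 => (1 + x) / (1 - x)
  | _ => 1
  end.

(* Main.v *)
Require Import Defs.
From mathcomp Require Import all_boot all_order all_algebra.
From mathcomp Require Import complex mxtens ring zify.
From mathcomp Require Import all_classical all_reals all_analysis.

(** The contradiction is found close to the highest weight. Let e_a be the basis
    vector of V_3 that lies a steps below the highest weight vector. The weight
    spaces of V_3 (x) V_3 that are at most three steps below the top meet only
    V_6, V_5, V_4 and V_3, so that there R depends only on r_6 = 1, r_5, r_4 and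
    r_3, and its matrix elements follow from explicit q-Clebsch-Gordan vectors
    ([spectral_column]). To know how R acts on these vectors one needs the sum of
    the V_j to be direct; it is, because the quantum Casimir element takes
    distinct values on them for generic q ([Vcomp_direct]).

    The Yang-Baxter equation at (t, - t) gives unitarity r_j(t) r_j(- t) = 1,
    which determines r_j up to second order by its slope at 0: the second
    coefficient is half the square of the first ([jet_unitary]). Let x, y, z be
    the slopes of r_5, r_4, r_3. At (t, t), the terms of order t^3 in a matrix
    element of the Yang-Baxter equation then give a polynomial equation in
    x, y, z ([jet_cubic]). The element from e_0 e_0 e_2 to e_1 e_1 e_0 yields
       y A1 = (q - q^-1)^2 A0                      ([cubicA], after division by x)
    and the sum of the elements from e_0 e_0 e_3 and e_3 e_0 e_0 to e_1 e_1 e_1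
       y B1 + (q - q^-1)^2 B0 = 0                  ([cubicB]).
    At q = 1 both hold as soon as y = 0, which is the case for the given R-matrix.
    For generic q, however, the factor (q - q^-1)^2 can be cancelled when y is
    eliminated, and A0 B1 + A1 B0 = 0 ([obstruction_eq0]). This combination is
    continuous in q, x, y, z up to q = 1, and at q = 1 with the classical slopes
    x = 2, y = 0, z = 1/2 it equals - 27 / 11 ([obstruction_classical]): the
    two equations would make y vanish like (q - 1)^2 with incompatible leading
    coefficients.

    Convergence of the r_j as analytic functions implies that of their slopes
    ([slope_cvg]). This is Cauchy's estimate for the first Taylor coefficient,
    obtained here without contour integrals: averaging a power series over the
    two square roots of its argument keeps the constant term and the bound, and
    keeps only every second coefficient ([circle_mean]). *)

Set Implicit Arguments.
Unset Strict Implicit.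
Unset Printing Implicit Defensive.

Import Order.TTheory GRing.Theory Num.Theory.
Import numFieldNormedType.Exports.
Local Open Scope classical_set_scope.
Local Open Scope ring_scope.

(** * A Cauchy estimate by averaging over square roots *)

Section PowerSeries.
Variable R : realType.
Local Notation C := (Cplx R).
Implicit Types (a b : nat -> C) (f g h : C -> C) (x e rho K M theta : C).

Lemma Cplx_archimedean e : 0 < e -> exists n : nat, n.+1%:R^-1 < e.
Proof.
case: e => u v; rewrite ltcE /= => /andP[/eqP -> u0].
have [n nu] : exists n : nat, n.+1%:R^-1 < u.
  exists (Num.bound u^-1); rewrite invf_plt ?posrE //.
  have := archi_boundP (ltW (_ : 0 < u^-1)); rewrite invr_gt0 => /(_ u0) ub.
  by apply: lt_le_trans ub _; rewrite ler_nat.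
exists n.
have -> : (n.+1%:R^-1 : C) = (n.+1%:R^-1 : R)%:C%C.
  by rewrite -(rmorph_nat (real_complex R)) -fmorphV.
by rewrite ltcE /= eqxx.
Qed.

Lemma expr_half_lt e : 0 < e -> exists n : nat, (2^-1 : C) ^+ n < e.
Proof.
move=> /Cplx_archimedean[n ne]; exists n.+1; apply: le_lt_trans ne.
rewrite exprVn lef_pV2 ?posrE ?exprn_gt0 ?ltr0n //.
by rewrite -natrX ler_nat ltnW // ltn_expl.
Qed.

(** The partial sums satisfy the stronger bound 2 K (theta^n - theta^(n + m)),
    which goes through an induction on m because 1 + 2 theta <= 2. *)
Lemma geometric_tail b (s : C) K theta n :
    series b @ \oo --> s -> 0 <= theta -> theta <= 2^-1 -> 0 <= K ->
    (forall k, `|b k| <= K * theta ^+ k) ->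
  `|s - series b n| <= 2 * K * theta ^+ n.
Proof.
move=> bs th0 th2 K0 bK.
have part m : `|series b (n + m)%N - series b n|
    <= 2 * K * theta ^+ n - 2 * K * theta ^+ (n + m).
  elim: m => [|m IHm]; first by rewrite addn0 !subrr normr0.
  rewrite addnS seriesEnat /= big_nat_recr //= -addrA addrC -addrA.
  have -> : - \sum_(0 <= k < n) b k + \sum_(0 <= k < n + m) b k =
     series b (n + m)%N - series b n by rewrite seriesEnat /= addrC.
  apply: le_trans (ler_normD _ _) _.
  apply: le_trans (lerD (bK _) IHm) _.
  rewrite addrCA lerD2l lerNr opprB lerBrDr addrC.
  rewrite exprS.
  have -> : K * theta ^+ (n + m) + 2 * K * (theta * theta ^+ (n + m)) =
    K * theta ^+ (n + m) * (1 + 2 * theta) by ring.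
  rewrite [2 * K * _](_ : _ = K * theta ^+ (n + m) * 2); last by ring.
  apply: ler_wpM2l; first by rewrite mulr_ge0 ?exprn_ge0.
  rewrite -[leRHS](_ : 1 + 1 = _); last by ring.
  by rewrite lerD2l mulrC -ler_pdivlMr // div1r.
apply/ler_addgt0Pr => e e0.
have /cvgrPdist_lt/(_ _ e0)[N _ NP] := bs.
have := NP (n + N)%N (leq_addl _ _) => /= sN.
rewrite -[s](subrK (series b (n + N)%N)) -addrA.
apply: le_trans (ler_normD _ _) _; rewrite [leRHS]addrC; apply: lerD; first exact: ltW.
apply: le_trans (part N) _; rewrite gerBl.
by rewrite !mulr_ge0 ?exprn_ge0.
Qed.

(** The mean value inequality on a circle. Replacing h(x) by the mean of its
    values at the two square roots of x, that is b_k by b_(2k), r by r^2 and theta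
    by theta^2, changes neither b_0 nor the bound M; after m steps only an error
    of order theta^(2^m) separates b_0 from a value of the series. *)
Lemma circle_mean m : forall b h K M theta (r : C),
    0 < r -> 0 <= theta -> theta <= 2^-1 -> 0 <= K ->
    (forall x, `|x| = r -> series (fun k => b k * x ^+ k) @ \oo --> h x) ->
    (forall x, `|x| = r -> `|h x| <= M) ->
    (forall k, `|b k| * r ^+ k <= K * theta ^+ k) ->
  `|b 0%N| <= M + 2 * K * theta ^+ (2 ^ m).
Proof.
elim: m => [|m IHm] b h K M theta r r0 th0 th2 K0 bh hM bK.
  have nr : `|r| = r by rewrite ger0_norm ?ltW.
  have := @geometric_tail _ (h r) K theta 1 (bh r nr) th0 th2 K0.
  rewrite seriesEnat /= big_nat1 expr0 mulr1 => tl.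
  rewrite -[b 0%N](subrK (h r)) addrC.
  apply: le_trans (ler_normD _ _) _; apply: lerD; first exact: hM.
  rewrite distrC; apply: tl => k.
  by rewrite normrM normrX nr.
have sqn x : `|x| = r ^+ 2 -> `|sqrtC x| = r.
  move=> xr; apply/eqP; rewrite -(@eqrXn2 _ 2) ?(ltW r0)//.
  by rewrite -normrX sqrtCK xr.
pose h2 x := (h (sqrtC x) + h (- sqrtC x)) / 2.
rewrite expnS exprM; apply: (IHm (fun k => b (2 * k)%N) h2 K M (theta ^+ 2) (r ^+ 2)).
- exact: exprn_gt0.
- exact: exprn_ge0.
- rewrite expr2; apply: le_trans (_ : theta * 1 <= _); last by rewrite mulr1.
  by apply: ler_wpM2l => //; apply: le_trans th2 _; rewrite invf_le1 ?ler1n ?ltr0n.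
- by [].
- move=> x xr.
  have -> : series (fun k => b (2 * k)%N * x ^+ k) =
    (fun n => (series (fun k => b k * sqrtC x ^+ k) (2 * n)%N +
               series (fun k => b k * (- sqrtC x) ^+ k) (2 * n)%N) / 2).
    apply/funext; elim=> [|n IHn].
      by rewrite muln0 !seriesEnat /= !big_geq // addr0 mul0r.
    rewrite mulnS add2n.
    have xy : x = sqrtC x ^+ 2 by rewrite sqrtCK.
    rewrite !seriesSr IHn [in X in _ + X = _]xy; move: (sqrtC x) => y.
    rewrite !(exprSr _ (2 * n)) !exprM sqrrN; move: ((y ^+ 2) ^+ n) => z.
    move: (series _ _) (series _ _) => S1 S2; move: (b _) (b _) => b1 b2.
    by field.
  have sub (u : nat -> C) l : u @ \oo --> l -> (u (2 * n)%N @[n --> \oo] --> l).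
    move=> ul; apply: cvg_comp ul.
    move=> A [N _ NA]; exists N => // k /= Nk; apply: NA => /=.
    by apply: leq_trans Nk _; rewrite leq_pmull.
  apply: cvgMl; apply: cvgD; apply: sub; apply: bh; rewrite ?normrN; exact: sqn.
- move=> x xr; rewrite normrM normfV (ger0_norm (ler0n _ 2)) ler_pdivrMr ?ltr0n //.
  apply: le_trans (ler_normD _ _) _; rewrite mulr_natr mulr2n.
  by apply: lerD; apply: hM; rewrite ?normrN sqn.
- by move=> k; rewrite -!exprM.
Qed.

(** The terms of the convergent series at r tend to 0, hence are bounded. *)
Lemma series_coef_bounded a f rho (r : C) :
    (forall x, `|x| < rho -> series (fun k => a k * x ^+ k) @ \oo --> f x) ->
    0 < r -> r < rho ->
  exists2 K, 0 <= K & forall k, `|a k| * r ^+ k <= K.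
Proof.
move=> af r0 rr.
have nr : `|r| = r by rewrite ger0_norm ?ltW.
have : cvgn (series (fun k => a k * r ^+ k)).
  by apply/cvg_ex; exists (f r); apply: af; rewrite nr.
move/cvg_series_cvg_0/cvgr0Pnorm_lt => /(_ 1 ltr01)[N _ NP].
exists (1 + \sum_(0 <= i < N) `|a i| * r ^+ i) => [|k].
  apply: addr_ge0; first exact: ler01.
  by apply: sumr_ge0 => i _; rewrite mulr_ge0 ?normr_ge0 // exprn_ge0 // ltW.
have s0 (m : nat) : 0 <= \sum_(0 <= i < m) `|a i| * r ^+ i.
  by apply: sumr_ge0 => i _; rewrite mulr_ge0 ?normr_ge0 // exprn_ge0 // ltW.
have [Nk|kN] := leqP N k.
  have := NP k Nk => /=; rewrite normrM normrX nr => /ltW le1.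
  by apply: le_trans le1 _; rewrite lerDl.
rewrite (bigD1_seq k) ?mem_index_iota ?iota_uniq //=.
rewrite addrCA lerDl; apply: addr_ge0; first exact: ler01.
by apply: sumr_ge0 => i _; rewrite mulr_ge0 ?normr_ge0 // exprn_ge0 // ltW.
Qed.

Lemma series_at0 a f rho :
    0 < rho ->
    (forall x, `|x| < rho -> series (fun k => a k * x ^+ k) @ \oo --> f x) ->
  f 0 = a 0%N.
Proof.
move=> rho0 /(_ 0); rewrite normr0 => /(_ rho0) f0.
apply: (cvg_unique _ f0); first exact: norm_hausdorff.
apply: (@cvg_near_cst _ C); exists 1%N => // -[|n] //= _.
rewrite seriesEnat /= big_nat_recl // expr0 mulr1 big1 ?addr0 // => i _.
by rewrite expr0n mulr0.
Qed.

(** Cauchy's estimate with a constant 8 in place of 1: [circle_mean] is applied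
    to (f(x) - f(0)) / x on the circle of radius rho / 4, where the bound on
    the coefficients coming from radius rho / 2 gives theta = 1 / 2. *)
Lemma coef1_le a f rho M :
    0 < rho ->
    (forall x, `|x| < rho -> series (fun k => a k * x ^+ k) @ \oo --> f x) ->
    (forall x, `|x| < rho -> `|f x| <= M) ->
  `|a 1%N| <= 8 * M / rho.
Proof.
move=> rho0 af fM.
pose r1 := rho / 2; pose r := rho / 4.
have r10 : 0 < r1 by rewrite divr_gt0 ?ltr0n.
have r0 : 0 < r by rewrite divr_gt0 ?ltr0n.
have r1rho : r1 < rho by rewrite ltr_pdivrMr ?ltr0n // ltr_pMr // ltr1n.
have rrho : r < rho by rewrite ltr_pdivrMr ?ltr0n // ltr_pMr // ltr1n.
have [K K0 Ka] := series_coef_bounded af r10 r1rho.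
have f0 := series_at0 rho0 af.
pose h x := (f x - a 0%N) / x.
have bh x : `|x| = r -> series (fun k => a k.+1 * x ^+ k) @ \oo --> h x.
  move=> xr.
  have x0 : x != 0 by rewrite -normr_gt0 xr.
  have -> : series (fun k => a k.+1 * x ^+ k) =
      (fun n => (series (fun k => a k * x ^+ k) n.+1 - a 0%N) / x).
    apply/funext=> n; rewrite !seriesEnat /= big_nat_recl // expr0 mulr1 [a 0%N + _]addrC addrK.
    rewrite mulr_suml; apply: eq_bigr => i _.
    by rewrite exprSr mulrA mulfK.
  apply: cvgMl; apply: cvgB; last exact: cvg_cst.
  by rewrite cvg_shiftS; apply: af; rewrite xr.
have hM x : `|x| = r -> `|h x| <= 8 * M / rho.
  move=> xr; rewrite normrM normfV xr ler_pdivrMr //.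
  have -> : 8 * M / rho * r = M + M by rewrite /r; field; rewrite gt_eqF.
  apply: le_trans (ler_normB _ _) _; apply: lerD; first by apply: fM; rewrite xr.
  by rewrite -f0; apply: fM; rewrite normr0.
have half0 : (0 : C) <= 2^-1 by rewrite invr_ge0 ler0n.
have bK k : `|a k.+1| * r ^+ k <= K / r1 * 2^-1 ^+ k.
  have -> : r = r1 * 2^-1 by rewrite /r /r1; field.
  rewrite exprMn mulrA; apply: ler_wpM2r; first exact: exprn_ge0.
  by rewrite ler_pdivlMr // -mulrA -exprSr.
have K10 : 0 <= K / r1 by rewrite divr_ge0 // ltW.
apply/ler_addgt0Pr => e e0.
have D0 : 0 < 2 * (K / r1) + 1 by rewrite ltr_wpDl ?ltr01 // mulr_ge0 ?ler0n.
have [n ne] := expr_half_lt (divr_gt0 e0 D0).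
apply: le_trans (circle_mean n r0 half0 (lexx _) K10 bh hM bK) _.
rewrite lerD2l; move: ne; rewrite ltr_pdivlMr // => /ltW; apply: le_trans.
rewrite mulrC; apply: ler_pM; rewrite ?exprn_ge0 ?lerDl ?ler01 ?(mulr_ge0 (ler0n _ 2) K10) //.
have half1 : (2^-1 : C) <= 1 by rewrite invf_le1 ?ler1n ?ltr0n.
by apply: (ler_wiXn2l half0 half1); rewrite ltnW // ltn_expl.
Qed.
End PowerSeries.

(** * Second-order jets at the origin *)

Definition at0 (R : realType) : set_system (Cplx R) := nbhs (0 : Cplx R).
Arguments at0 {R}.

#[local] Instance at0_filter (R : realType) : ProperFilter (@at0 R).
Proof. exact: nbhs_pfilter. Qed.

Section Jets.
Variable R : realType.
Local Notation C := (Cplx R).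
Implicit Types (a b : nat -> C) (f g h V X Y W : C -> C) (x t e rho K M : C).

Lemma cvg_id0 : t @[t --> at0] --> (0 : C).
Proof. exact: cvg_id. Qed.

(** f(t) = u t + v t^2 + o(t^2). *)
Definition jet f (u v : C) :=
  exists V, (\forall t \near at0, f t = t * (u + t * V t))
         /\ V t @[t --> at0] --> v.

Definition slope f : C := lim ((f t - f 0) / t @[t --> (0 : C)^']).

Lemma cvg_dnbhs V (v : C) :
  V t @[t --> at0] --> v -> V t @[t --> (0 : C)^'] --> v.
Proof. by move=> Vv A /Vv; exact: nbhs_dnbhs. Qed.

Lemma jet_slope f u v : jet (fun t => f t - f 0) u v -> slope f = u.
Proof.
move=> [V [fV Vv]]; apply: (@cvg_lim C); first exact: norm_hausdorff.
have lim0 : u + t * V t @[t --> at0] --> u + 0 * v.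
  by apply: cvgD; [exact: cvg_cst | apply: cvgM; [exact: cvg_id0 | exact: Vv]].
rewrite mul0r addr0 in lim0.
apply: cvg_trans (cvg_dnbhs lim0); apply: near_eq_cvg.
have ne : \forall t \near (0 : C)^', t != 0 by exact: nbhs_dnbhs_neq.
have fV' : \forall t \near (0 : C)^', f t - f 0 = t * (u + t * V t).
  exact: nbhs_dnbhs fV.
near=> t.
have t0 : t != 0 by exact: (near ne).
by rewrite (near fV' t) // [RHS]mulrC mulKf.
Unshelve. all: by end_near.
Qed.

Lemma jetD f g u v u' v' :
  jet f u v -> jet g u' v' -> jet (fun t => f t + g t) (u + u') (v + v').
Proof.
move=> [V [fV Vv]] [W [gW Wv]]; exists (fun t => V t + W t); split.
  near=> t; rewrite (near fV t) // (near gW t) //; ring.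
by apply: cvgD; [exact: Vv | exact: Wv].
Unshelve. all: by end_near.
Qed.

Lemma jetZ f u v k : jet f u v -> jet (fun t => k * f t) (k * u) (k * v).
Proof.
move=> [V [fV Vv]]; exists (fun t => k * V t); split.
  near=> t; rewrite (near fV t) //; ring.
by apply: cvgMr; exact: Vv.
Unshelve. all: by end_near.
Qed.

Lemma near0_mul (P : C -> Prop) k :
  (\forall t \near at0, P t) -> \forall t \near at0, P (k * t).
Proof.
move=> nP.
have : k * t @[t --> at0] --> k * 0 by apply: cvgMr; exact: cvg_id0.
by rewrite mulr0; apply.
Qed.

Lemma cvg0_mul V (v k : C) :
  V t @[t --> at0] --> v -> V (k * t) @[t --> at0] --> v.
Proof.
have c : k * t @[t --> at0] --> k * (0 : C) by apply: cvgMr; exact: cvg_id0.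
by rewrite mulr0 in c => Vv; exact: (cvg_comp _ _ c Vv).
Qed.

Lemma eq_limit0 V W (v w : C) :
    V t @[t --> at0] --> v -> W t @[t --> at0] --> w ->
    (\forall t \near at0, t != 0 -> V t = W t) -> v = w.
Proof.
move=> Vv Ww VW.
apply: (@cvg_unique C _ (V t @[t --> (0 : C)^'])); first exact: norm_hausdorff.
  exact: cvg_dnbhs.
apply: cvg_trans (cvg_dnbhs Ww); apply: near_eq_cvg.
have ne : \forall t \near (0 : C)^', t != 0 by exact: nbhs_dnbhs_neq.
have VW' : \forall t \near (0 : C)^', t != 0 -> V t = W t by exact: nbhs_dnbhs VW.
near=> t.
by rewrite (near VW' t) //; exact: (near ne).
Unshelve. all: by end_near.
Qed.

(** The coefficient of t^2 in (1 + f(t)) (1 + f(- t)) is 2 v - u^2. *)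
Lemma jet_unitary f u v :
    jet f u v -> (\forall t \near at0, (1 + f t) * (1 + f (- t)) = 1) ->
  v = u ^+ 2 / 2.
Proof.
move=> [V [fV Vv]] f1.
have Vv' : V (- t) @[t --> at0] --> v.
  by under eq_fun do rewrite -mulN1r; exact: cvg0_mul.
have fV' : \forall t \near at0, f (- t) = - t * (u - t * V (- t)).
  have := near0_mul (-1) fV; apply: filterS => t; rewrite mulN1r => ->.
  by rewrite !mulNr.
pose W t := V t + V (- t) - u ^+ 2 + u * t * (V (- t) - V t) + t ^+ 2 * (V t * V (- t)).
have : v + v - u ^+ 2 + u * 0 * (v - v) + 0 ^+ 2 * (v * v) = 0.
  apply: (@eq_limit0 W (fun=> 0)); last 1 first.
  - near=> t => t0.
    have E : (1 + f t) * (1 + f (- t)) = 1 by exact: (near f1).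
    rewrite (near fV t) // (near fV' t) // in E.
    apply: (mulfI (expf_neq0 2 t0)); rewrite mulr0.
    by apply: (addrI 1); rewrite addr0 -[RHS]E // /W; ring.
  - apply: cvgD; first apply: cvgD; first apply: cvgB; first by apply: cvgD; [exact: Vv | exact: Vv'].
    + exact: cvg_cst.
    + by apply: cvgM; [apply: cvgMr; exact: cvg_id0 | apply: cvgB; [exact: Vv' | exact: Vv]].
    + by apply: cvgM; [apply: cvgM; exact: cvg_id0 | apply: cvgM; [exact: Vv | exact: Vv']].
  - exact: cvg_cst.
rewrite mulr0 mul0r expr0n mul0r !addr0 => /eqP.
by rewrite subr_eq0 => /eqP <-; field.
Unshelve. all: by end_near.
Qed.

(** The equation is compared at order t^3. The order t^2 is trivial since
    X(2t) Y(t) and X(t) Y(2t) have the same leading term; at order t^3 they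
    differ by 2 (x2 y1 - x1 y2), and each product on the right contributes twice
    the product of its leading coefficients. *)
Lemma jet_cubic X Y W (A B D A' B' D' : C -> C)
    (x1 x2 y1 y2 w1 w2 a1 a2 b1 b2 d1 d2 a1' a2' b1' b2' d1' d2' : C) :
    jet X x1 x2 -> jet Y y1 y2 -> jet (fun t => W t - 1) w1 w2 ->
    jet A a1 a2 -> jet B b1 b2 -> jet D d1 d2 ->
    jet A' a1' a2' -> jet B' b1' b2' -> jet D' d1' d2' ->
    (\forall t \near at0, X (2 * t) * Y t =
       X t * Y (2 * t) * W t + A t * B (2 * t) * D t
       + A' t * B' (2 * t) * D' t) ->
  x2 * y1 - x1 * y2 = x1 * y1 * w1 + a1 * b1 * d1 + a1' * b1' * d1'.
Proof.
move=> [VX [eX cX]] [VY [eY cY]] [VW [eW1 cW]] [VA [eA cA]] [VB [eB cB]]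
  [VD [eD cD]] [VA' [eA' cA']] [VB' [eB' cB']] [VD' [eD' cD']] E.
have eW : \forall t \near at0, W t = 1 + t * (w1 + t * VW t).
  by apply: filterS eW1 => t <-; rewrite addrC subrK.
have eX2 := near0_mul 2 eX; have eY2 := near0_mul 2 eY.
have eB2 := near0_mul 2 eB; have eB2' := near0_mul 2 eB'.
pose lo V (u t : C) := u + t * V t.
pose lo2 V (u t : C) := u + 2 * t * V (2 * t).
have clo V (u v : C) : V t @[t --> at0] --> v -> lo V u t @[t --> at0] --> u.
  move=> Vv; rewrite (_ : nbhs u = nbhs (u + 0 * v)); last by rewrite mul0r addr0.
  by apply: cvgD; [exact: cvg_cst | apply: cvgM; [exact: cvg_id0 | exact: Vv]].
have clo2 V (u v : C) : V t @[t --> at0] --> v -> lo2 V u t @[t --> at0] --> u.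
  move=> Vv; rewrite (_ : nbhs u = nbhs (u + 2 * 0 * v)); last first.
    by rewrite mulr0 mul0r addr0.
  apply: cvgD; [exact: cvg_cst | apply: cvgM; last exact: cvg0_mul].
  by apply: cvgMr; exact: cvg_id0.
pose P t := 2 * VX (2 * t) * y1 + x1 * VY t + 2 * t * VX (2 * t) * VY t
  - (VX t * y1 + 2 * x1 * VY (2 * t) + 2 * t * VX t * VY (2 * t)).
pose Q t := lo VX x1 t * lo2 VY y1 t * lo VW w1 t
  + lo VA a1 t * lo2 VB b1 t * lo VD d1 t
  + lo VA' a1' t * lo2 VB' b1' t * lo VD' d1' t.
have lim : (2 * x2 * y1 + x1 * y2 + 2 * 0 * x2 * y2
    - (x2 * y1 + 2 * x1 * y2 + 2 * 0 * x2 * y2)) =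
    x1 * y1 * w1 + a1 * b1 * d1 + a1' * b1' * d1'.
  apply: (@eq_limit0 P Q).
  - have c2t : 2 * t @[t --> at0] --> 2 * (0 : C) by apply: cvgMr; exact: cvg_id0.
    have cX2 := cvg0_mul 2 cX; have cY2 := cvg0_mul 2 cY.
    apply: cvgB; apply: cvgD; first apply: cvgD.
    + by apply: cvgMl; apply: cvgMr; exact: cX2.
    + by apply: cvgMr; exact: cY.
    + by apply: cvgM; last exact: cY; apply: cvgM; last exact: cX2; exact: c2t.
    + by apply: cvgD; [apply: cvgMl; exact: cX | apply: cvgMr; exact: cY2].
    + by apply: cvgM; last exact: cY2; apply: cvgM; last exact: cX; exact: c2t.
  - apply: cvgD; first apply: cvgD.
    + by apply: cvgM; [apply: cvgM; [exact: clo cX | exact: clo2 cY] | exact: clo cW].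
    + by apply: cvgM; [apply: cvgM; [exact: clo cA | exact: clo2 cB] | exact: clo cD].
    + by apply: cvgM; [apply: cvgM; [exact: clo cA' | exact: clo2 cB'] | exact: clo cD'].
  - near=> t => t0.
    have Et : X (2 * t) * Y t = X t * Y (2 * t) * W t + A t * B (2 * t) * D t
       + A' t * B' (2 * t) * D' t by exact: (near E).
    rewrite (near eX t) // (near eY t) // (near eW t) // (near eA t) //
      (near eD t) // (near eA' t) // (near eD' t) // (near eX2 t) // (near eY2 t) //
      (near eB2 t) // (near eB2' t) // in Et.
    apply: (mulfI (mulf_neq0 (_ : 2 != 0 :> C) (expf_neq0 3 t0))).
      by rewrite pnatr_eq0.
    apply/eqP; rewrite -subr_eq0; apply/eqP.
    transitivity (2 * t * (x1 + 2 * t * VX (2 * t)) * (t * (y1 + t * VY t)) -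
      (t * (x1 + t * VX t) * (2 * t * (y1 + 2 * t * VY (2 * t))) * (1 + t * (w1 + t * VW t)) +
      t * (a1 + t * VA t) * (2 * t * (b1 + 2 * t * VB (2 * t))) * (t * (d1 + t * VD t)) +
      t * (a1' + t * VA' t) * (2 * t * (b1' + 2 * t * VB' (2 * t))) *
      (t * (d1' + t * VD' t)))).
      by rewrite /P /Q /lo /lo2; ring.
    by rewrite Et subrr.
by rewrite -lim; ring.
Unshelve. all: by end_near.
Qed.
End Jets.

(** * Taylor coefficients and convergence of slopes *)

Section Coefficients.
Variable R : realType.
Local Notation C := (Cplx R).
Implicit Types (a b : nat -> C) (f g : C -> C) (x t e rho K M : C).

(** The tail of the series from index 3 on is of order t^3 by
    [geometric_tail]. *)
Lemma jet_of_series a f rho :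
    0 < rho ->
    (forall x, `|x| < rho -> series (fun k => a k * x ^+ k) @ \oo --> f x) ->
  jet (fun t => f t - f 0) (a 1%N) (a 2%N).
Proof.
move=> rho0 af; have f0 := series_at0 rho0 af.
pose r := rho / 2.
have r0 : 0 < r by rewrite divr_gt0 ?ltr0n.
have rrho : r < rho by rewrite ltr_pdivrMr ?ltr0n // ltr_pMr // ltr1n.
have [K K0 Ka] := series_coef_bounded af r0 rrho.
pose V t := if t == 0 then a 2%N else (f t - a 0%N - a 1%N * t) / t ^+ 2.
have fE t : f t - f 0 = t * (a 1%N + t * V t).
  rewrite /V; case: eqP => [->|/eqP t0]; first by rewrite subrr mul0r.
  by rewrite f0; field.
have VK t : `|t| <= r / 2 -> `|V t - a 2%N| <= 2 * K / r ^+ 3 * `|t|.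
  move=> tr; rewrite /V; case: eqP => [->|/eqP t0].
    by rewrite subrr normr0 mulr0.
  have tn0 : 0 < `|t| by rewrite normr_gt0.
  have trho : `|t| < rho.
    apply: le_lt_trans tr _; apply: lt_trans rrho.
    by rewrite ltr_pdivrMr ?ltr0n // ltr_pMr // ltr1n.
  have th0 : 0 <= `|t| / r by rewrite divr_ge0 // ltW.
  have th2 : `|t| / r <= 2^-1 by rewrite ler_pdivrMr // mulrC.
  have := @geometric_tail R _ (f t) K _ 3 (af t trho) th0 th2 K0.
  rewrite seriesEnat /= !big_nat_recr //= big_geq // add0r expr0 mulr1 expr1.
  have bK k : `|a k * t ^+ k| <= K * (`|t| / r) ^+ k.
    rewrite normrM normrX expr_div_n mulrCA [leLHS]mulrC; apply: ler_wpM2l.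
      exact: exprn_ge0.
    by rewrite ler_pdivlMr ?exprn_gt0.
  move=> /(_ bK) tl.
  have -> : (f t - a 0%N - a 1%N * t) / t ^+ 2 - a 2%N =
     (f t - (a 0%N + a 1%N * t + a 2%N * t ^+ 2)) / t ^+ 2 by field.
  rewrite normrM normfV normrX ler_pdivrMr ?exprn_gt0 //.
  apply: le_trans tl _; rewrite le_eqVlt; apply/orP; left; apply/eqP.
  by field; rewrite gt_eqF.
exists V; split; first by near=> t.
apply/cvgrPdist_le => e e0.
have D0 : 0 < 2 * K / r ^+ 3 + 1.
  by rewrite ltr_wpDl ?ltr01 // divr_ge0 ?mulr_ge0 ?ler0n ?exprn_ge0 // ltW.
have n1 : \forall t \near at0, `|t| < r / 2.
  by apply: (@nbhs0_lt C C); rewrite divr_gt0 ?ltr0n.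
have n2 : \forall t \near at0, `|t| < e / (2 * K / r ^+ 3 + 1).
  by apply: (@nbhs0_lt C C); rewrite divr_gt0.
near=> t.
have tr : `|t| < r / 2 by exact: (near n1).
have te : `|t| < e / (2 * K / r ^+ 3 + 1) by exact: (near n2).
rewrite distrC; apply: le_trans (VK _ (ltW tr)) _.
move: te; rewrite ltr_pdivlMr // => /ltW; apply: le_trans.
by rewrite mulrC; apply: ler_wpM2l; rewrite ?lerDl ?ler01.
Unshelve. all: by end_near.
Qed.

Lemma analytic_jet f : analytic_near0 f ->
  exists v, jet (fun t => f t - f 0) (slope f) v.
Proof.
move=> [rho rho0 [a af]]; have J := jet_of_series rho0 af.
by exists (a 2%N); rewrite (jet_slope J).
Qed.

(** The slope of g - f_q is its first Taylor coefficient, which [coef1_le] bounds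
    by the supremum of |g - f_q| on a disc. *)
Lemma slope_cvg (F : set_system C) (FF : Filter F) (fq : C -> C -> C) g :
    cvg_analytic_near0 F fq g -> analytic_near0 g ->
  slope (fq q) @[q --> F] --> slope g.
Proof.
move=> [rho1 rho10 [afq cfq]] [rho2 rho20 [b bg]].
have [rho rho0 [rle1 rle2]] : exists2 rho : C, 0 < rho & rho <= rho1 /\ rho <= rho2.
  have rr : rho1 >=< rho2 by apply: real_comparable; exact: gtr0_real.
  case: (comparable_leP rr) => h; [exists rho1|exists rho2] => //; split=> //.
  exact: ltW.
have bg' x : `|x| < rho -> series (fun k => b k * x ^+ k) @ \oo --> g x.
  by move=> xr; apply: bg; apply: lt_le_trans xr _.
have sg := jet_slope (jet_of_series rho0 bg').
apply/cvgrPdist_le => e e0.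
pose M := e * rho / 8.
have M0 : 0 < M by rewrite divr_gt0 ?mulr_gt0 ?ltr0n.
have ub : \forall q \near F, forall x, `|x| < rho1 -> `|g x - fq q x| < M.
  apply: (cfq [set h | forall x, `|x| < rho1 -> `|g x - h x| < M]).
  apply/uniform_nbhs; exists [set xy | `|xy.1 - xy.2| < M]; split => //.
  have := @entourage_ball C C (PosNum M0).
  by apply: filterS => -[x y] /=; rewrite -ball_normE.
near=> q.
have [a aq] : analytic_on_disc rho1 (fq q) by exact: (near afq).
have uq : forall x, `|x| < rho1 -> `|g x - fq q x| < M by exact: (near ub).
have aq' x : `|x| < rho -> series (fun k => a k * x ^+ k) @ \oo --> fq q x.
  by move=> xr; apply: aq; apply: lt_le_trans xr _.
rewrite (jet_slope (jet_of_series rho0 aq')) sg.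
have := @coef1_le R (fun k => b k - a k) (fun x => g x - fq q x) rho M rho0.
have -> : 8 * M / rho = e by rewrite /M; field; rewrite gt_eqF.
apply=> x xr.
  have -> : series (fun k => (b k - a k) * x ^+ k) =
     (fun n => series (fun k => b k * x ^+ k) n - series (fun k => a k * x ^+ k) n).
    apply/funext => n; rewrite !seriesEnat /= -sumrB.
    by apply: eq_bigr => i _; rewrite mulrBl.
  by apply: cvgB; [exact: bg' | exact: aq'].
by apply: ltW; apply: uq; apply: lt_le_trans xr _.
Unshelve. all: by end_near.
Qed.

End Coefficients.

(** * The classical coefficients *)

Section Moebius.
Variable R : realType.
Local Notation C := (Cplx R).
Implicit Types (x c e : C).

(** (c + x) / (c - x) = 1 + 2 x / c + 2 (x / c)^2 + ... *)
Definition moebius_coef c (k : nat) : C := if k is 0 then 1 else 2 / c ^+ k.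

Lemma moebius_series c : 0 < c -> forall x, `|x| < c / 2 ->
  series (fun k => moebius_coef c k * x ^+ k) @ \oo --> (c + x) / (c - x).
Proof.
move=> c0 x xc.
have cn0 : c != 0 by rewrite gt_eqF.
have z2 : `|x / c| <= 2^-1.
  by rewrite normrM normfV (gtr0_norm c0) ler_pdivrMr // mulrC ltW.
have d2 : 2^-1 <= `|1 - x / c|.
  apply: le_trans (lerB_dist _ _); rewrite normr1 lerBrDr.
  apply: le_trans (lerD (lexx _) z2) _.
  by rewrite le_eqVlt; apply/orP; left; apply/eqP; field.
have dn0 : 1 - x / c != 0.
  by rewrite -normr_gt0; apply: lt_le_trans d2; rewrite invr_gt0 ltr0n.
have cx0 : c - x != 0.
  have -> : c - x = c * (1 - x / c) by field.
  by rewrite mulf_neq0.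
have rem n : (c + x) / (c - x) - series (fun k => moebius_coef c k * x ^+ k) n.+1
   = 2 * (x / c) ^+ n.+1 / (1 - x / c).
  elim: n => [|n IHn].
    rewrite seriesEnat /= big_nat1 /= expr0 mulr1.
    by field; rewrite cx0 cn0.
  have -> : series (fun k => moebius_coef c k * x ^+ k) n.+2 =
    series (fun k => moebius_coef c k * x ^+ k) n.+1 + 2 * (x / c) ^+ n.+1.
    rewrite seriesSr /= expr_div_n.
    by congr (_ + _); rewrite mulrA mulrAC.
  rewrite opprD addrA IHn (exprS _ n.+1); move: (_ ^+ n.+1) => w.
  by field; rewrite cx0 cn0.
apply/cvgrPdist_le => e e0.
have [n0 ne] := expr_half_lt (divr_gt0 e0 (ltr0n _ 4)).
exists n0.+1 => // -[|n] //= nn; rewrite rem normrM normfV normrM normrX.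
rewrite ler_pdivrMr ?normr_gt0 // (ger0_norm (ler0n _ 2)).
have half0 : (0 : C) <= 2^-1 by rewrite invr_ge0 ler0n.
have half1 : (2^-1 : C) <= 1 by rewrite invf_le1 ?ler1n ?ltr0n.
apply: (@le_trans _ _ (2 * (e / 4))); last first.
  have -> : 2 * (e / 4) = e * 2^-1 by field.
  by apply: ler_wpM2l => //; exact: ltW.
apply: ler_wpM2l; first exact: ler0n.
apply: le_trans (ltW ne); apply: (@le_trans _ _ (2^-1 ^+ n.+1)).
  by apply: lerXn2r => //; rewrite nnegrE.
by apply: (ler_wiXn2l half0 half1); exact: ltnW.
Qed.

Lemma moebius_analytic c : 0 < c -> analytic_near0 (fun x => (c + x) / (c - x)).
Proof.
move=> c0; exists (c / 2); first by rewrite divr_gt0 ?ltr0n.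
by exists (moebius_coef c); exact: moebius_series.
Qed.

Lemma moebius_slope c : 0 < c -> slope (fun x => (c + x) / (c - x)) = 2 / c.
Proof.
move=> c0; have c20 : 0 < c / 2 by rewrite divr_gt0 ?ltr0n.
by rewrite (jet_slope (jet_of_series c20 (moebius_series c0))) /= expr1.
Qed.

Lemma one_series x :
  series (fun k => (k == 0%N)%:R * x ^+ k) @ \oo --> (1 : C).
Proof.
apply: (@cvg_near_cst _ C); exists 1%N => // -[|n] //= _.
rewrite seriesEnat /= big_nat_recl // expr0 mulr1 big1 ?addr0 // => i _.
by rewrite mul0r.
Qed.

Lemma one_analytic : analytic_near0 (fun=> 1 : C).
Proof. by exists 1; [exact: ltr01 | exists (fun k => (k == 0%N)%:R) => x _; exact: one_series]. Qed.

Lemma one_slope : slope (fun=> 1 : C) = 0.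
Proof.
exact: (jet_slope (@jet_of_series _ (fun k => (k == 0%N)%:R) _ 1 ltr01
  (fun x _ => one_series x))).
Qed.

End Moebius.

(** * The quantum Casimir element and the action of R on highest weight modules *)

Section ComplexExponential.
Variable R : realType.
Local Notation C := (Cplx R).

Lemma cexpD (x y : C) : cexp (x + y) = cexp x * cexp y.
Proof.
case: x => a b; case: y => c d; apply/eqP; rewrite eq_complex /cexp /=.
by rewrite expRD cosD sinD; apply/andP; split; apply/eqP; ring.
Qed.

Lemma cexp0 : cexp (0 : C) = 1.
Proof.
by apply/eqP; rewrite eq_complex /cexp /= expR0 cos0 sin0 mulr0 mulr1 !eqxx.
Qed.

Lemma cexp_neq0 (x : C) : cexp x != 0.
Proof.
apply/negP => /eqP x0; have := cexpD x (- x).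
by rewrite subrr cexp0 x0 mul0r => /eqP; rewrite oner_eq0.
Qed.

Lemma cexpN (x : C) : cexp (- x) = (cexp x)^-1.
Proof.
by apply: (mulfI (cexp_neq0 x)); rewrite -cexpD subrr cexp0 divff ?cexp_neq0.
Qed.

Lemma qpowD (l s t : C) : qpow l (s + t) = qpow l s * qpow l t.
Proof. by rewrite /qpow mulrDl cexpD. Qed.

Lemma qpowN (l t : C) : qpow l (- t) = (qpow l t)^-1.
Proof. by rewrite /qpow mulNr cexpN. Qed.

Lemma qpow_neq0 (l t : C) : qpow l t != 0.
Proof. exact: cexp_neq0. Qed.

Lemma qpow1 (l : C) : qpow l 1 = cexp l.
Proof. by rewrite /qpow mul1r. Qed.

Lemma qpow0 (l : C) : qpow l 0 = 1.
Proof. by rewrite /qpow mul0r cexp0. Qed.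

Lemma qpow_nat (l : C) (m : nat) : qpow l m%:R = cexp l ^+ m.
Proof.
elim: m => [|m IHm]; first by rewrite qpow0.
by rewrite -addn1 natrD qpowD IHm qpow1 exprD expr1.
Qed.

End ComplexExponential.

Lemma tens_diag_mx (K : comPzRingType) m p (a : 'rV[K]_m) (b : 'rV[K]_p) :
  diag_mx a *t diag_mx b =
  diag_mx (\row_k (a 0 (mxtens_unindex k).1 * b 0 (mxtens_unindex k).2)).
Proof.
apply/matrixP => i j; case: (mxtens_indexP i) => i1 i2; case: (mxtens_indexP j) => j1 j2.
rewrite tensmxE !mxE !mxtens_indexK /= (can_eq (@mxtens_indexK m p)) xpair_eqE.
by case: (i1 == j1); case: (i2 == j2); rewrite ?mulr0n ?mulr1n ?mul0r ?mulr0.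
Qed.

Lemma tens_scalar_mxl (K : comPzRingType) m m' p p' (k : K) (A : 'M[K]_(m, m'))
    (B : 'M[K]_(p, p')) : (k *: A) *t B = k *: (A *t B).
Proof. by apply/matrixP => i j; rewrite !mxE mulrA. Qed.

Lemma tens_scalar_mxr (K : comPzRingType) m m' p p' (k : K) (A : 'M[K]_(m, m'))
    (B : 'M[K]_(p, p')) : A *t (k *: B) = k *: (A *t B).
Proof. by apply/matrixP => i j; rewrite !mxE mulrCA. Qed.

Lemma tensmxBl (K : comPzRingType) m m' p p' (A A' : 'M[K]_(m, m'))
    (B : 'M[K]_(p, p')) : (A - A') *t B = A *t B - A' *t B.
Proof. by apply/matrixP => i j; rewrite !mxE mulrBl. Qed.

Lemma tensmxBr (K : comPzRingType) m m' p p' (A : 'M[K]_(m, m'))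
    (B B' : 'M[K]_(p, p')) : A *t (B - B') = A *t B - A *t B'.
Proof. by apply/matrixP => i j; rewrite !mxE mulrBr. Qed.

(** In the commutator of the coproducts A v + k A and B v + k B the two
    mixed terms cancel, since k and v scale A by inverse factors. *)
Lemma tens_commutator (K : fieldType) m (A B k v : 'M[K]_m) (z : K) :
    k *m A = z *: (A *m k) -> k *m B = z^-1 *: (B *m k) ->
    v *m A = z^-1 *: (A *m v) -> v *m B = z *: (B *m v) ->
  (A *t v + k *t A) *m (B *t v + k *t B) - (B *t v + k *t B) *m (A *t v + k *t A) =
  (A *m B - B *m A) *t (v *m v) + (k *m k) *t (A *m B - B *m A).
Proof.
move=> kA kB vA vB; rewrite !mulmxDl !mulmxDr !tensmx_mul kA kB vA vB.
rewrite !tens_scalar_mxl !tens_scalar_mxr tensmxBl tensmxBr.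
move: (_ *t _) (z *: _) (z^-1 *: _) (_ *t _) ((B *m A) *t _) (_ *t (B *m A)).
move=> a b c e f g; apply/matrixP => i j; rewrite !mxE; ring.
Qed.

Lemma tens_conj (K : fieldType) m (B k v c : 'M[K]_m) (z : K) :
    c *m B = z *: (B *m c) -> c *m k = k *m c -> c *m v = v *m c ->
  (c *t c) *m (B *t v + k *t B) = z *: ((B *t v + k *t B) *m (c *t c)).
Proof.
move=> cB ck cv; rewrite mulmxDr mulmxDl !tensmx_mul cB ck cv scalerDr.
by rewrite tens_scalar_mxl tens_scalar_mxr.
Qed.

Lemma subV_sqr_neq0 (K : fieldType) (z : K) :
  z != 0 -> z - z^-1 != 0 -> z * z - 1 != 0.
Proof.
move=> z0; apply: contra => /eqP z2.
by rewrite -(mulKf z0 (z - z^-1)) mulrBr divff // z2 mulr0.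
Qed.

(** The Casimir element is (z - 1/z)^2 Y X + z c + v / z, where c and v stand for
    q^(2 S^z) and q^(- 2 S^z): moving Y across Y X produces a multiple of c - v,
    which the scaling of c and v by Y compensates. *)
Lemma casimir_comm (K : fieldType) m (X Y c v : 'M[K]_m) (z : K) :
    z != 0 -> z - z^-1 != 0 ->
    X *m Y - Y *m X = (z - z^-1)^-1 *: (c - v) ->
    c *m Y = z ^- 2 *: (Y *m c) -> v *m Y = z ^+ 2 *: (Y *m v) ->
  ((z - z^-1) ^+ 2 *: (Y *m X) + z *: c + z^-1 *: v) *m Y =
  Y *m ((z - z^-1) ^+ 2 *: (Y *m X) + z *: c + z^-1 *: v).
Proof.
move=> z0 zd /eqP; rewrite subr_eq => /eqP XY cY vY.
rewrite !mulmxDl !mulmxDr -!scalemxAl -!scalemxAr cY vY.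
rewrite -[Y *m X *m Y]mulmxA XY mulmxDr -scalemxAr mulmxBr.
move: (Y *m (Y *m X)) (Y *m c) (Y *m v) => P Q S.
by apply/matrixP => i j; rewrite !mxE; field; rewrite z0 subV_sqr_neq0.
Qed.

(** On a highest weight vector only the two diagonal terms survive. *)
Lemma casimir_highest (K : fieldType) m p (H : 'M[K]_(p, m)) (X Y c v : 'M[K]_m)
    (u z a b : K) :
    H *m X^T = 0 -> H *m c^T = a *: H -> H *m v^T = b *: H ->
  H *m (u *: (Y *m X) + z *: c + z^-1 *: v)^T = (z * a + z^-1 * b) *: H.
Proof.
move=> HX Hc Hv.
have -> : (u *: (Y *m X) + z *: c + z^-1 *: v)^T =
    u *: (X^T *m Y^T) + z *: c^T + z^-1 *: v^T.
  by rewrite !linearD /= !linearZ /= trmx_mul.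
by rewrite !mulmxDr -!scalemxAr mulmxA HX mul0mx scaler0 add0r Hc Hv !scalerA -scalerDl.
Qed.

Lemma eigen_mulX (K : fieldType) m p (H : 'M[K]_(p, m)) (A Y : 'M[K]_m) (a : K) k :
  H *m A = a *: H -> A *m Y = Y *m A -> H *m (Y ^+ k) *m A = a *: (H *m (Y ^+ k)).
Proof.
move=> HA AY; elim: k => [|k IHk]; first by rewrite expr0 mulmx1.
by rewrite exprSr -mulmxE !mulmxA -(mulmxA _ Y) -AY mulmxA IHk -scalemxAl.
Qed.

Lemma mulmx_lowered (K : fieldType) m p (Y : 'M[K]_m) (v : 'M[K]_(m, p)) k :
  (Y ^+ k *m v)^T = v^T *m (Y^T ^+ k).
Proof.
elim: k => [|k IHk]; first by rewrite !expr0 mul1mx mulmx1.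
by rewrite exprS -mulmxE -mulmxA trmx_mul IHk exprSr -mulmxE -mulmxA.
Qed.

Section QuantumCasimir.
Variables (R : realType) (l : Cplx R) (n : nat).
Local Notation C := (Cplx R).
Hypothesis q_generic : generic (cexp l).
Local Notation q := (cexp l).
Local Notation d := (q - q^-1).
Local Notation Sp := (Sp l n).
Local Notation Sm := (Sm l n).
Local Notation K := (qSz l n).
Local Notation coSp := (coSp l n).
Local Notation coSm := (coSm l n).

Lemma q_neq0 : q != 0. Proof. exact: cexp_neq0. Qed.

Lemma qBV_neq0 : d != 0.
Proof.
case: q_generic => q0 /(_ 2%N isT); apply: contraNneq => /eqP.
by rewrite subr_eq0 => /eqP q2; rewrite expr2 {1}q2 mulVf.
Qed.

Lemma qnumE (t : C) : qnum l t = (qpow l t - (qpow l t)^-1) / d.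
Proof.
rewrite /qnum; case: eqP => [q1|_]; last by rewrite qpowN.
by case: q_generic => _ /(_ 1%N isT); rewrite expr1 q1 eqxx.
Qed.

Lemma qSzD (a b : C) : K a *m K b = K (a + b).
Proof.
rewrite /qSz mul_diag_mx; apply/matrixP => i j; rewrite !mxE.
by rewrite mulrDl qpowD mulrnAr.
Qed.

Lemma qSzSp (a : C) : K a *m Sp = qpow l a *: (Sp *m K a).
Proof.
rewrite /qSz mul_diag_mx mul_mx_diag; apply/matrixP => i j; rewrite !mxE.
case: eqP => [ij|_]; last by rewrite mul0r !mulr0.
by rewrite /wt ij mulrBr mulrBr -natr1 mulrDr mulr1 !qpowD; ring.
Qed.

Lemma qSzSm (a : C) : K a *m Sm = qpow l (- a) *: (Sm *m K a).
Proof.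
rewrite /qSz mul_diag_mx mul_mx_diag; apply/matrixP => i j; rewrite !mxE.
case: eqP => [ij|_]; last by rewrite mul0r !mulr0.
rewrite /wt -ij mulrBr mulrBr -natr1 mulrDr mulr1 !qpowD qpowN.
by field; rewrite qpow_neq0.
Qed.

Lemma qnum0 : qnum l 0 = 0.
Proof. by rewrite qnumE qpow0 invr1 subrr mul0r. Qed.

Lemma spinD : spin R n + spin R n = n%:R.
Proof. by rewrite /spin; field. Qed.

Lemma SpSmE i j : (Sp *m Sm) i j =
  (qnum l (spin R n - wt R i + 1) * qnum l (spin R n + wt R i)) *+ (i == j).
Proof.
rewrite mxE; case: i => [[|i] ilt].
  rewrite big1 => [|k _]; last by rewrite !mxE /= mul0r.
  by rewrite /wt /= sub0r subrr qnum0 mulr0 mul0rn.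
have iln : (i < n.+1)%N by exact: ltnW.
rewrite (bigD1 (Ordinal iln)) //= big1 => [|k].
  rewrite !mxE /= eqxx addr0 -(inj_eq val_inj) /=; case: eqP => [ij|_]; last by rewrite mulr0.
  by rewrite mulr1n /wt /= -ij -natr1; congr (qnum l _ * qnum l _); ring.
rewrite -(inj_eq val_inj) /= !mxE /= eqSS eq_sym => /negPf ->.
by rewrite mul0r.
Qed.

Lemma SmSpE i j : (Sm *m Sp) i j =
  (qnum l (spin R n + wt R i + 1) * qnum l (spin R n - wt R i)) *+ (i == j).
Proof.
rewrite mxE; have [ilt|] := ltnP i n; last first.
  move=> nli; have in_ : i = n :> nat.
    by apply/eqP; rewrite eqn_leq nli -ltnS ltn_ord.
  rewrite big1 => [|k _].
    rewrite (_ : spin R n - wt R i = 0) ?qnum0 ?mulr0 ?mul0rn //.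
    by rewrite /wt in_ opprB addrA spinD subrr.
  by rewrite !mxE in_ gtn_eqF ?ltn_ord // mul0r.
have iln : (i.+1 < n.+1)%N by [].
rewrite (bigD1 (Ordinal iln)) //= big1 => [|k].
  rewrite !mxE /= eqxx addr0 eqSS (inj_eq val_inj); case: eqP => [<-|_]; last by rewrite mulr0.
  by rewrite mulr1n /wt /= -natr1; congr (qnum l _ * qnum l _); ring.
rewrite -(inj_eq val_inj) /= !mxE /= eq_sym => /negPf ->.
by rewrite mul0r.
Qed.

Lemma SpSm : Sp *m Sm - Sm *m Sp = d^-1 *: (K 2 - K (- 2)).
Proof.
have subE (A B : 'M[C]_n.+1) i j : (A - B) i j = A i j - B i j by rewrite !mxE.
apply/matrixP => i j; rewrite subE SpSmE SmSpE mxE subE !mxE -!mulNrn.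
rewrite -!mulrnDl; case: (i == j); rewrite ?mulr0n ?mulr0 // !mulr1n.
have -> : 2 * wt R i = wt R i + wt R i by ring.
have -> : -1 *+ 2 * wt R i = - (wt R i + wt R i) by ring.
rewrite !qnumE !(qpowD, qpowN) qpow1.
move: (qpow_neq0 l (spin R n)) (qpow_neq0 l i%:R) q_neq0 qBV_neq0.
move: (qpow l (spin R n)) (qpow l i%:R) (cexp l) => s w z s0 w0 z0 zd.
by field; rewrite s0 w0 z0 subV_sqr_neq0.
Qed.

Local Notation coK a := (K a *t K a).

Lemma coSpSm : coSp *m coSm - coSm *m coSp = d^-1 *: (coK 2 - coK (- 2)).
Proof.
have q1V : qpow l (- - 1) = cexp l by rewrite opprK qpow1.
have qV1 : qpow l (- 1) = (cexp l)^-1 by rewrite qpowN qpow1.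
rewrite /coSp /coSm (@tens_commutator _ _ Sp Sm (K 1) (K (- 1)) q).
- rewrite SpSm !qSzD tens_scalar_mxl tens_scalar_mxr -scalerDr; congr (_ *: _).
  have -> : (1 + 1 : C) = 2 by ring.
  have -> : (-1 - 1 : C) = - 2 by ring.
  by rewrite tensmxBl tensmxBr addrC subrKA.
- by rewrite qSzSp qpow1.
- by rewrite qSzSm qV1.
- by rewrite qSzSp qV1.
- by rewrite qSzSm q1V.
Qed.

Lemma coKSm a : coK a *m coSm = qpow l (- a) *: (coSm *m coK a).
Proof.
apply: tens_conj; first exact: qSzSm.
- by rewrite 2!qSzD; congr qSz; ring.
- by rewrite 2!qSzD; congr qSz; ring.
Qed.

Definition casimir : 'M[C]_(n.+1 * n.+1) :=
  d ^+ 2 *: (coSm *m coSp) + q *: coK 2 + q^-1 *: coK (- 2).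

Lemma casimirC : casimir *m coSm = coSm *m casimir.
Proof.
have q2 : qpow l 2 = cexp l ^+ 2 by rewrite -[2]/(2%:R) qpow_nat.
apply: casimir_comm; first exact: q_neq0.
- exact: qBV_neq0.
- exact: coSpSm.
- by rewrite coKSm qpowN q2.
- by rewrite coKSm opprK q2.
Qed.

Definition casimir_eig (j : nat) : C := q ^+ (2 * j).+1 + q ^- (2 * j).+1.

(** Both coproducts are diagonal, so an eigenvector of the one of S^z is
    supported on basis vectors where q^(a S^z) takes a single value. *)
Lemma coSz_row (j : nat) m (W : 'M[C]_(m, n.+1 * n.+1)) a :
  W *m (coSz R n)^T = j%:R *: W -> W *m (coK a)^T = qpow l (a * j%:R) *: W.
Proof.
rewrite /coSz /Sz -!diag_const_mx /qSz !tens_diag_mx -!raddfD /= !tr_diag_mx => WZ.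
apply/matrixP => i k; have /matrixP/(_ i k) := WZ.
rewrite !mul_mx_diag !mxE mulr1 mul1r -qpowD -mulrDr.
have [->|w0] := eqVneq (W i k) 0; first by rewrite !(mul0r, mulr0).
by rewrite [RHS]mulrC => /(mulfI w0) ->; rewrite mulrC.
Qed.

Lemma Vcomp_casimir (j : nat) : (Vcomp l n j <= eigenspace casimir^T (casimir_eig j))%MS.
Proof.
apply/sumsmx_subP => m _.
set H := hwspace l n j; set Y := coSm^T.
have HX : H *m coSp^T = 0 by apply/sub_kermxP; exact: capmxSl.
have HZ : H *m (coSz R n)^T = j%:R *: H by apply/eigenspaceP; exact: capmxSr.
have HC : H *m casimir^T = casimir_eig j *: H.
  have -> : casimir_eig j = q * qpow l (2 * j%:R) + q^-1 * qpow l (- 2 * j%:R).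
    by rewrite mulNr qpowN -natrM qpow_nat /casimir_eig !exprS invfM.
  apply: casimir_highest; [exact: HX | exact: coSz_row HZ | exact: coSz_row HZ].
apply/eigenspaceP; apply: eigen_mulX; first exact: HC.
by rewrite -!trmx_mul casimirC.
Qed.

(** A + 1/A = B + 1/B means (A - B) (A B - 1) = 0, and for generic q neither
    q^(2j+1) / q^(2i+1) nor q^(2i+1) q^(2j+1) is 1. *)
Lemma casimir_eig_inj : injective casimir_eig.
Proof.
suff H i j : (i <= j)%N -> casimir_eig i = casimir_eig j -> i = j.
  move=> i j ij; have [ji|/ltnW ji] := leqP i j; first exact: H.
  by apply/esym/H.
move=> ij; rewrite /casimir_eig => E; apply/eqP; rewrite eqn_leq ij leqNgt.
case: q_generic => q0 qX; apply/negP => ji.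
have Xn0 m : q ^+ m != 0 by rewrite expf_neq0.
set a := q ^+ (2 * i).+1 in E; set b := q ^+ (2 * j).+1 in E.
have : (a - b) * (a * b - 1) = 0.
  have a0 : a != 0 by exact: Xn0.
  have b0 : b != 0 by exact: Xn0.
  transitivity (a * b * (a + a^-1 - (b + b^-1))); first by field; rewrite a0 b0.
  by rewrite E subrr mulr0.
move/eqP; rewrite mulf_eq0 => /orP[|].
  have -> : b = a * q ^+ (2 * (j - i)) by rewrite /a /b -exprD; congr (_ ^+ _); lia.
  rewrite -[X in X - _]mulr1 -mulrBr mulf_eq0 (negPf (Xn0 _)) /= subr_eq0 eq_sym.
  by apply/negP/qX; lia.
by rewrite /a /b -exprD subr_eq0; apply/negP/qX.
Qed.

(** The components lie in eigenspaces of the Casimir element for distinct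
    eigenvalues. *)
Lemma Vcomp_direct (j : 'I_n.+1) :
  (Vcomp l n j :&: \sum_(i < n.+1 | i != j) Vcomp l n i)%MS = 0.
Proof.
have : mxdirect (\sum_(i < n.+1) eigenspace casimir^T (casimir_eig i)).
  apply: mxdirect_sum_eigenspace => i k _ _ /casimir_eig_inj ik.
  exact: val_inj.
move/mxdirect_sumsP => /(_ j isT) E.
apply/eqP; rewrite -submx0 -[X in (_ <= X)%MS]E; apply: capmxS; first exact: Vcomp_casimir.
apply/sumsmx_subP => i ij; apply: (sumsmx_sup i) => //; exact: Vcomp_casimir.
Qed.

(** The projections defining R act as the identity or as 0 only thanks to the
    directness of the sum of the components. *)
Lemma Rop_Vcomp m (r : 'I_n.+1 -> C -> C) x (j : 'I_n.+1) (w : 'M[C]_(n.+1 * n.+1, m)) :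
  (w^T <= Vcomp l n j)%MS -> Rop l r x *m w = r j x *: w.
Proof.
move=> wj; rewrite /Rop mulmx_suml (bigD1 j) //= big1 => [|i ij].
  rewrite addr0 -scalemxAl; congr (_ *: _).
  by apply: trmx_inj; rewrite trmx_mul trmxK proj_mx_id ?Vcomp_direct.
rewrite -scalemxAl; apply: trmx_inj; rewrite linearZ /= trmx_mul trmxK.
rewrite proj_mx_0 ?Vcomp_direct ?scaler0 ?trmx0 //.
by apply: (sumsmx_sup j) => //; rewrite eq_sym.
Qed.

Lemma hw_Vcomp (j m p : nat) (v : 'M[C]_(n.+1 * n.+1, p)) :
    (m <= 2 * j)%N -> coSp *m v = 0 -> coSz R n *m v = j%:R *: v ->
  ((coSm ^+ m *m v)^T <= Vcomp l n j)%MS.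
Proof.
move=> mj vX vZ.
rewrite mulmx_lowered; apply: (sumsmx_sup (Ordinal (mj : (m < (2 * j).+1)%N))) => //=.
apply: submxMr; rewrite sub_capmx; apply/andP; split.
  by apply/sub_kermxP; rewrite -trmx_mul vX trmx0.
by apply/eigenspaceP; rewrite -trmx_mul vZ linearZ.
Qed.

End QuantumCasimir.

(** * Vectors near the highest weight *)

Definition br (F : fieldType) (q : F) (n : nat) : F := (q ^+ n - q ^- n) / (q - q^-1).

Lemma tensmxA (K : comPzRingType) m m' n n' p p'
    (A : 'M[K]_(m, m')) (B : 'M[K]_(n, n')) (D : 'M[K]_(p, p')) :
  castmx (mulnA m n p, mulnA m' n' p') (A *t (B *t D)) = A *t B *t D.
Proof.
apply/matrixP => i j; rewrite castmxE.
case: (mxtens_indexP i) => i12 i3; case: (mxtens_indexP i12) => i1 i2.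
case: (mxtens_indexP j) => j12 j3; case: (mxtens_indexP j12) => j1 j2.
have -> : cast_ord (esym (mulnA m n p)) (mxtens_index (mxtens_index (i1, i2), i3)) =
   mxtens_index (i1, mxtens_index (i2, i3)) by apply: val_inj => /=; lia.
have -> : cast_ord (esym (mulnA m' n' p')) (mxtens_index (mxtens_index (j1, j2), j3)) =
   mxtens_index (j1, mxtens_index (j2, j3)) by apply: val_inj => /=; lia.
by rewrite !tensmxE mulrA.
Qed.

Section SpinThreeVectors.
Variables (R : realType) (l : Cplx R).
Local Notation C := (Cplx R).
Hypothesis q_generic : generic (cexp l).
Local Notation q := (cexp l).
Local Notation p := (cexp l)^-1.
Local Notation "[# n ]" := (br (cexp l) n) (at level 0, format "[# n ]").

(** The index of the basis vector lying a steps below the highest weight vector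
    of V_3; the matrix S^z is increasing along the indices. *)
Definition dv (a : nat) : 'I_7 := inord (6 - a).
Definition evec (a : nat) : 'cV[C]_7 := delta_mx (dv a) 0.
Definition e2 (a b : nat) : 'M[C]_(7 * 7, 1 * 1) := evec a *t evec b.

Lemma dvE a : dv a = (6 - a)%N :> nat.
Proof. by rewrite /dv inordK // ltnS leq_subr. Qed.

Lemma wt_dv a : (a <= 6)%N -> wt R (dv a) = 3 - a%:R.
Proof.
move=> a6; rewrite /wt dvE natrB // /spin.
by field.
Qed.

Lemma spin3 : spin R 6 = 3.
Proof. by rewrite /spin; field. Qed.

Lemma qnum_br m : qnum l m%:R = [#m].
Proof. by rewrite qnumE // qpow_nat. Qed.

Lemma br_neq0 m : (0 < m)%N -> [#m] != 0.
Proof.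
move=> m0; rewrite /br mulf_neq0 ?invr_eq0 ?qBV_neq0 //.
case: q_generic => q0 qX; apply: contraNneq (qX (2 * m)%N _) => [/eqP|]; last by rewrite muln_gt0.
by rewrite subr_eq0 mul2n -addnn exprD => /eqP {1}->; rewrite mulVf ?expf_neq0.
Qed.

Lemma Sm_evec a : (a < 6)%N -> Sm l 6 *m evec a = [#(6 - a)] *: evec a.+1.
Proof.
move=> a6; apply/matrixP => i k; rewrite -colE !mxE ord1 eqxx andbT.
rewrite wt_dv ?(ltnW a6) // spin3 -(inj_eq val_inj) /= !dvE -qnum_br natrB ?(ltnW a6) //.
have -> : (i == 6 - a.+1 :> nat)%N = (i.+1 == 6 - a)%N by apply/eqP/eqP; lia.
case: eqP => _; rewrite ?mulr0 ?mulr1 //; congr (qnum l _); ring.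
Qed.

Lemma Sp_evec a : (a <= 6)%N -> Sp l 6 *m evec a = [#a] *: evec a.-1.
Proof.
move=> a6; apply/matrixP => i k; rewrite -colE !mxE ord1 eqxx andbT.
rewrite wt_dv // spin3 -(inj_eq val_inj) /= !dvE -qnum_br.
case: a a6 => [|a] a6.
  rewrite mulr0n qnum0 // mul0r; case: eqP => // i7.
  by have := ltn_ord i; rewrite i7.
have -> : (i == (6 - a.+1).+1 :> nat)%N = (i == 6 - a :> nat)%N by apply/eqP/eqP; lia.
case: eqP => _; rewrite ?mulr0 ?mulr1 //; congr (qnum l _); ring.
Qed.

Lemma Sz_evec a : (a <= 6)%N -> Sz R 6 *m evec a = (3 - a%:R) *: evec a.
Proof.
move=> a6; rewrite mul_diag_mx; apply/matrixP => i k; rewrite !mxE.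
by case: eqP => [->|_] /=; rewrite ?mulr0 // wt_dv.
Qed.

Lemma qSz_evec c a : (a <= 6)%N ->
  qSz l 6 c *m evec a = qpow l (c * (3 - a%:R)) *: evec a.
Proof.
move=> a6; rewrite mul_diag_mx; apply/matrixP => i k; rewrite !mxE.
by case: eqP => [->|_] /=; rewrite ?mulr0 // wt_dv.
Qed.

Lemma qSz1_evec a : (a <= 3)%N -> qSz l 6 1 *m evec a = q ^+ (3 - a) *: evec a.
Proof.
move=> a3; rewrite qSz_evec; last exact: leq_trans a3 _.
by rewrite mul1r -natrB // qpow_nat.
Qed.

Lemma qSzN1_evec a : (a <= 3)%N -> qSz l 6 (- 1) *m evec a = p ^+ (3 - a) *: evec a.
Proof.
move=> a3; rewrite qSz_evec; last exact: leq_trans a3 _.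
by rewrite mulN1r -natrB // qpowN qpow_nat exprVn.
Qed.

Lemma coSm_e2 a b : (a <= 3)%N -> (b <= 3)%N -> coSm l 6 *m e2 a b =
  ([#(6 - a)] * p ^+ (3 - b)) *: e2 a.+1 b + (q ^+ (3 - a) * [#(6 - b)]) *: e2 a b.+1.
Proof.
move=> a3 b3; rewrite mulmxDl !tensmx_mul qSz1_evec // qSzN1_evec //.
rewrite !Sm_evec; [|by apply: leq_ltn_trans b3 _|by apply: leq_ltn_trans a3 _].
by rewrite !tens_scalar_mxl !tens_scalar_mxr !scalerA [_ * [#(6 - b)]]mulrC.
Qed.

Lemma coSp_e2 a b : (a <= 3)%N -> (b <= 3)%N -> coSp l 6 *m e2 a b =
  ([#a] * p ^+ (3 - b)) *: e2 a.-1 b + (q ^+ (3 - a) * [#b]) *: e2 a b.-1.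
Proof.
move=> a3 b3; rewrite mulmxDl !tensmx_mul qSz1_evec // qSzN1_evec //.
rewrite !Sp_evec; [|by apply: leq_trans b3 _|by apply: leq_trans a3 _].
by rewrite !tens_scalar_mxl !tens_scalar_mxr !scalerA [_ * [#b]]mulrC.
Qed.

Lemma coSz_e2 a b : (a + b <= 6)%N -> coSz R 6 *m e2 a b = (6 - (a + b))%N%:R *: e2 a b.
Proof.
move=> ab; have a6 : (a <= 6)%N by apply: leq_trans ab; exact: leq_addr.
have b6 : (b <= 6)%N by apply: leq_trans ab; exact: leq_addl.
rewrite mulmxDl !tensmx_mul !Sz_evec // !mul1mx tens_scalar_mxl tens_scalar_mxr.
by rewrite -scalerDl natrB // natrD; congr (_ *: _); ring.
Qed.

(** w is proportional to the m-th lowering of a highest weight vector of weight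
    j, hence lies in V_j. *)
Definition lowered (j m : nat) (w : 'M[C]_(7 * 7, 1 * 1)) :=
  (m <= 2 * j)%N /\ exists v k, [/\ coSp l 6 *m v = 0, coSz R 6 *m v = j%:R *: v
     & w = k *: (coSm l 6 ^+ m *m v)].

Lemma lowered_highest j v :
  coSp l 6 *m v = 0 -> coSz R 6 *m v = j%:R *: v -> lowered j 0 v.
Proof. by split=> //; exists v, 1; rewrite expr0 mul1mx scale1r. Qed.

Lemma loweredS j m w w' (k : C) : (m < 2 * j)%N -> k != 0 ->
  lowered j m w -> coSm l 6 *m w = k *: w' -> lowered j m.+1 w'.
Proof.
move=> mj k0 [_ [v [c [v1 v2 wE]]]] E; split=> //; exists v, (k^-1 * c); split=> //.
by rewrite -[w'](scalerK k0) -E wE -scalemxAr scalerA exprS -mulmxE -mulmxA.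
Qed.

Lemma Rop_lowered r x (j : 'I_7) m w : lowered j m w -> Rop l r x *m w = r j x *: w.
Proof.
move=> [mj [v [k [v1 v2 ->]]]]; rewrite -scalemxAr.
rewrite (Rop_Vcomp q_generic r x (hw_Vcomp mj v1 v2)).
by rewrite !scalerA mulrC.
Qed.

End SpinThreeVectors.

(** * Columns of an invariant operator *)

(** The common denominators of the columns below: K_Nm belongs to the weight
    space N steps below the top and to the vector obtained there by lowering a
    highest weight vector m times. They are functions of the sequence b of
    q-numbers, so that the sequence can be replaced by its limit at q = 1. *)
Section Normalizations.
Variables (F : fieldType) (b : nat -> F).
Local Notation "[# n ]" := (b n) (at level 0, format "[# n ]").

Definition K21 := [#2] * [#6] * [#5] / ([#10] * [#12]).
Definition K20 := [#6] * [#5] / ([#11] * [#10]).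
Definition K32 := [#3] * [#6] * [#5] / ([#4] * [#9] * [#10] * [#12]).
Definition K31 := [#3] * [#6] * [#5] / ([#4] * [#8] * [#11] * [#10]).
Definition K30 := [#6] * [#5] * [#4] / ([#10] * [#9] * [#8]).
End Normalizations.

Section Columns.
Variables (F : fieldType) (q f1 f2 f3 : F).
Local Notation p := q^-1.
Local Notation "[# n ]" := (br q n) (at level 0, format "[# n ]").
Local Notation k21 := (K21 (br q)).
Local Notation k20 := (K20 (br q)).
Local Notation k32 := (K32 (br q)).
Local Notation k31 := (K31 (br q)).
Local Notation k30 := (K30 (br q)).

(** The image of e_x (x) e_y under an operator with eigenvalues 1, 1 + f1, 1 + f2,
    1 + f3 on V_6, V_5, V_4, V_3, as the list of its coefficients on
    e_i (x) e_(x + y - i). *)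
Definition col01 := [:: 1 + [#6] * p ^+ 6 / [#12] * f1; - [#6] / [#12] * f1].
Definition col10 := [:: - [#6] / [#12] * f1; 1 + [#6] * q ^+ 6 / [#12] * f1].
Definition col02 := [:: 1 + k21 * f1 + p ^+ 10 * k20 * f2;
  - [#6] * (q - p) * k21 * f1 - [#2] * p ^+ 5 * k20 * f2; - k21 * f1 + k20 * f2].
Definition col20 := [:: - k21 * f1 + k20 * f2;
  [#6] * (q - p) * k21 * f1 - [#2] * q ^+ 5 * k20 * f2; 1 + k21 * f1 + q ^+ 10 * k20 * f2].
Definition col11 :=
  let x := [#6] * [#5] ^+ 2 / ([#10] * [#12]) in let y := [#5] ^+ 2 / ([#11] * [#10]) in
  [:: - (q - p) * x * f1 - p ^+ 5 * y * f2;
      1 + (q - p) ^+ 2 * [#6] * x * f1 + [#2] * y * f2;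
      (q - p) * x * f1 - q ^+ 5 * y * f2].
Definition col03 :=
  [:: 1 + [#4] ^+ 2 * q ^+ 6 * k32 * f1 + [#4] ^+ 2 * p ^+ 4 * k31 * f2 + p ^+ 12 * k30 * f3;
   - [#4] * [#6] * (q ^+ 10 - 1 - q ^+ 2) * k32 * f1
     + [#4] * ([#6] * p ^+ 8 - [#2] * [#5]) * k31 * f2 - [#3] * p ^+ 8 * k30 * f3;
   - [#4] * [#6] * (q ^+ 4 + q ^+ 6 - p ^+ 4) * k32 * f1
     + [#4] * ([#6] * q ^+ 4 - [#2] * [#5] * p ^+ 4) * k31 * f2 + [#3] * p ^+ 4 * k30 * f3;
   - [#4] ^+ 2 * k32 * f1 + [#4] ^+ 2 * k31 * f2 - k30 * f3].
Definition col30 :=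
  [:: - [#4] ^+ 2 * k32 * f1 + [#4] ^+ 2 * k31 * f2 - k30 * f3;
   - [#4] * [#6] * (p ^+ 4 + p ^+ 6 - q ^+ 4) * k32 * f1
     + [#4] * ([#6] * p ^+ 4 - [#2] * [#5] * q ^+ 4) * k31 * f2 + [#3] * q ^+ 4 * k30 * f3;
   - [#4] * [#6] * (p ^+ 10 - 1 - p ^+ 2) * k32 * f1
     + [#4] * ([#6] * q ^+ 8 - [#2] * [#5]) * k31 * f2 - [#3] * q ^+ 8 * k30 * f3;
   1 + [#4] ^+ 2 * p ^+ 6 * k32 * f1 + [#4] ^+ 2 * q ^+ 4 * k31 * f2 + q ^+ 12 * k30 * f3].

(** The basis vectors whose images are computed: up to two steps all of
    them, at three steps the two extreme ones. *)
Definition source (x y : nat) :=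
  (x + y <= 2)%N || [&& (x + y == 3)%N & (x == 0%N) || (y == 0%N)].

Definition column (x y i : nat) : F := (match x, y with
  | 0, 0 => [:: 1]
  | 0, 1 => col01 | 1, 0 => col10
  | 0, 2 => col02 | 1, 1 => col11 | 2, 0 => col20
  | 0, 3 => col03 | 3, 0 => col30
  | _, _ => [::] end)`_i.
End Columns.

(** In this section e a b is abstract, with the action of the generators on it
    given as hypotheses; this keeps the computations in a field with one
    parameter q. The vector [u]dm is obtained by lowering m times, up to a factor,
    the highest weight vector [u]d0 of the component V_(6-d). *)
Section Ladder.
Variables (F : fieldType) (q : F) (m n : nat) (e : nat -> nat -> 'M[F]_(m, n)).
Local Notation p := q^-1.
Local Notation "[# n ]" := (br q n) (at level 0, format "[# n ]").

Definition u00 := e 0 0.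
Definition u01 := p ^+ 3 *: e 1 0 + q ^+ 3 *: e 0 1.
Definition u02 := ([#5] * p ^+ 6) *: e 2 0 + ([#6] * [#2]) *: e 1 1 + ([#5] * q ^+ 6) *: e 0 2.
Definition u03 := ([#4] * p ^+ 9) *: e 3 0 + ([#6] * [#3] * p ^+ 3) *: e 2 1
  + ([#6] * [#3] * q ^+ 3) *: e 1 2 + ([#4] * q ^+ 9) *: e 0 3.
Definition u10 := q ^+ 3 *: e 1 0 - p ^+ 3 *: e 0 1.
Definition u11 := e 2 0 + ([#6] * (q - p)) *: e 1 1 - e 0 2.
Definition u12 := ([#4] * p ^+ 3) *: e 3 0 + ([#6] * (q + q ^+ 3 - p ^+ 7)) *: e 2 1
  + ([#6] * (q ^+ 7 - p ^+ 3 - p)) *: e 1 2 - ([#4] * q ^+ 3) *: e 0 3.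
Definition u20 := q ^+ 5 *: e 2 0 - [#2] *: e 1 1 + p ^+ 5 *: e 0 2.
Definition u21 := ([#4] * q ^+ 2) *: e 3 0 + ([#6] * q ^+ 6 - [#2] * [#5] * p ^+ 2) *: e 2 1
  + ([#6] * p ^+ 6 - [#2] * [#5] * q ^+ 2) *: e 1 2 + ([#4] * p ^+ 2) *: e 0 3.
Definition u30 := q ^+ 6 *: e 3 0 - ([#3] * q ^+ 2) *: e 2 1 + ([#3] * p ^+ 2) *: e 1 2
  - p ^+ 6 *: e 0 3.

Variables X Y Z : 'M[F]_m.
Hypothesis q0 : q != 0.
Hypothesis qd : q - q^-1 != 0.
Hypothesis Xe : forall a b, (a <= 3)%N -> (b <= 3)%N -> X *m e a b =
  ([#a] * p ^+ (3 - b)) *: e a.-1 b + (q ^+ (3 - a) * [#b]) *: e a b.-1.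
Hypothesis Ye : forall a b, (a <= 3)%N -> (b <= 3)%N -> Y *m e a b =
  ([#(6 - a)] * p ^+ (3 - b)) *: e a.+1 b + (q ^+ (3 - a) * [#(6 - b)]) *: e a b.+1.
Hypothesis Ze : forall a b, (a <= 3)%N -> (b <= 3)%N ->
  Z *m e a b = (6 - (a + b))%N%:R *: e a b.

Let qq : q * q - 1 != 0. Proof. exact: subV_sqr_neq0. Qed.

Local Ltac eval_nat :=
  change (3 - 0)%N with 3%N; change (3 - 1)%N with 2%N;
  change (3 - 2)%N with 1%N; change (3 - 3)%N with 0%N;
  change (6 - 0)%N with 6%N; change (6 - 1)%N with 5%N;
  change (6 - 2)%N with 4%N; change (6 - 3)%N with 3%N;
  change 0.-1%N with 0%N; change 1.-1%N with 0%N;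
  change 2.-1%N with 1%N; change 3.-1%N with 2%N;
  change (6 - (0 + 0))%N with 6%N;
  change (6 - (0 + 1))%N with 5%N;
  change (6 - (0 + 2))%N with 4%N;
  change (6 - (0 + 3))%N with 3%N;
  change (6 - (1 + 0))%N with 5%N;
  change (6 - (1 + 1))%N with 4%N;
  change (6 - (1 + 2))%N with 3%N;
  change (6 - (2 + 0))%N with 4%N;
  change (6 - (2 + 1))%N with 3%N;
  change (6 - (3 + 0))%N with 3%N.

Local Ltac vec_field :=
  let i := fresh in let j := fresh in
  apply/matrixP => i j; rewrite !mxE /br; field; rewrite ?q0 ?qq ?oner_neq0.

Local Ltac act lem :=
  rewrite ?(mulmxDr, mulmxN) -?scalemxAr ?lem //; eval_nat; vec_field.

Lemma Xu00 : X *m u00 = 0. Proof. by rewrite /u00; act Xe. Qed.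
Lemma Xu10 : X *m u10 = 0. Proof. by rewrite /u10; act Xe. Qed.
Lemma Xu20 : X *m u20 = 0. Proof. by rewrite /u20; act Xe. Qed.
Lemma Xu30 : X *m u30 = 0. Proof. by rewrite /u30; act Xe. Qed.

Lemma Zu00 : Z *m u00 = 6 *: u00. Proof. by rewrite /u00; act Ze. Qed.
Lemma Zu10 : Z *m u10 = 5 *: u10. Proof. by rewrite /u10; act Ze. Qed.
Lemma Zu20 : Z *m u20 = 4 *: u20. Proof. by rewrite /u20; act Ze. Qed.
Lemma Zu30 : Z *m u30 = 3 *: u30. Proof. by rewrite /u30; act Ze. Qed.

Lemma Yu00 : Y *m u00 = [#6] *: u01. Proof. by rewrite /u00 /u01; act Ye. Qed.
Lemma Yu01 : Y *m u01 = 1 *: u02. Proof. by rewrite /u01 /u02; act Ye. Qed.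
Lemma Yu02 : Y *m u02 = [#5] *: u03. Proof. by rewrite /u02 /u03; act Ye. Qed.
Lemma Yu10 : Y *m u10 = [#5] *: u11. Proof. by rewrite /u10 /u11; act Ye. Qed.
Lemma Yu11 : Y *m u11 = 1 *: u12. Proof. by rewrite /u11 /u12; act Ye. Qed.
Lemma Yu20 : Y *m u20 = 1 *: u21. Proof. by rewrite /u20 /u21; act Ye. Qed.

(** The basis vectors in terms of the [u]dm, cleared of denominators. *)
Lemma e10E : [#12] *: e 1 0 = ([#6] * q ^+ 3) *: u10 + ([#6] * p ^+ 3) *: u01.
Proof. by rewrite /u10 /u01; vec_field. Qed.
Lemma e01E : [#12] *: e 0 1 = - ([#6] * p ^+ 3) *: u10 + ([#6] * q ^+ 3) *: u01.
Proof. by rewrite /u10 /u01; vec_field. Qed.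
Lemma e02E : ([#10] * [#11] * [#12]) *: e 0 2 = ([#6] * [#5] * [#12] * p ^+ 5) *: u20
  - ([#6] * [#5] * [#2] * [#11]) *: u11 + ([#6] * [#10] * q ^+ 6) *: u02.
Proof. by rewrite /u20 /u11 /u02; vec_field. Qed.
Lemma e20E : ([#10] * [#11] * [#12]) *: e 2 0 = ([#6] * [#5] * [#12] * q ^+ 5) *: u20
  + ([#6] * [#5] * [#2] * [#11]) *: u11 + ([#6] * [#10] * p ^+ 6) *: u02.
Proof. by rewrite /u20 /u11 /u02; vec_field. Qed.
Lemma e11E : ([#10] * [#11] * [#12]) *: e 1 1 = - ([#5] ^+ 2 * [#12]) *: u20
  + ([#6] * [#5] ^+ 2 * [#11] * (q - p)) *: u11 + ([#6] * [#10]) *: u02.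
Proof. by rewrite /u20 /u11 /u02; vec_field. Qed.
Lemma e03E : ([#8] * [#9] * [#10] * [#11] * [#12]) *: e 0 3 = [#6] * [#5] *:
  (- ([#4] * [#11] * [#12] * p ^+ 6) *: u30 + ([#3] * [#9] * [#12] * p ^+ 2) *: u21
   - ([#3] * [#8] * [#11] * q ^+ 3) *: u12 + ([#8] * [#9] * q ^+ 9) *: u03).
Proof. by rewrite /u30 /u21 /u12 /u03; vec_field. Qed.
Lemma e30E : ([#8] * [#9] * [#10] * [#11] * [#12]) *: e 3 0 = [#6] * [#5] *:
  (([#4] * [#11] * [#12] * q ^+ 6) *: u30 + ([#3] * [#9] * [#12] * q ^+ 2) *: u21
   + ([#3] * [#8] * [#11] * p ^+ 3) *: u12 + ([#8] * [#9] * p ^+ 9) *: u03).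
Proof. by rewrite /u30 /u21 /u12 /u03; vec_field. Qed.

Variables (A : 'M[F]_m) (f1 f2 f3 : F).
Hypothesis br0 : forall k, (0 < k)%N -> [#k] != 0.
Hypotheses (A00 : A *m u00 = u00) (A01 : A *m u01 = u01)
  (A02 : A *m u02 = u02) (A03 : A *m u03 = u03).
Hypotheses (A10 : A *m u10 = (1 + f1) *: u10) (A11 : A *m u11 = (1 + f1) *: u11)
  (A12 : A *m u12 = (1 + f1) *: u12).
Hypotheses (A20 : A *m u20 = (1 + f2) *: u20) (A21 : A *m u21 = (1 + f2) *: u21).
Hypothesis A30 : A *m u30 = (1 + f3) *: u30.

(** The form in which the field tactic asks for the nonvanishing of the
    q-numbers. *)
Lemma expqq_neq0 k : (0 < k)%N -> (q * q) ^+ k - 1 != 0.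
Proof.
move=> k0; apply: contra (br0 k0) => /eqP/subr0_eq qk; rewrite /br mulf_eq0 subr_eq0.
have qk0 : q ^+ k != 0 by rewrite expf_neq0.
by rewrite -(inj_eq (mulfI qk0)) divff // -exprMn qk eqxx.
Qed.

(* The vectors are hidden while the operator is distributed over them. *)
Local Ltac expand_column lem :=
  let h00 := fresh in let h01 := fresh in let h02 := fresh in let h03 := fresh in
  let h10 := fresh in let h11 := fresh in let h12 := fresh in let h20 := fresh in
  let h21 := fresh in let h30 := fresh in let Eu01 := fresh in let Eu02 := fresh in
  let Eu03 := fresh in let Eu10 := fresh in let Eu11 := fresh in let Eu12 := fresh in
  let Eu20 := fresh in let Eu21 := fresh in let Eu30 := fresh in let v01 := fresh in
  let v02 := fresh in let v03 := fresh in let v10 := fresh in let v11 := fresh in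
  let v12 := fresh in let v20 := fresh in let v21 := fresh in let v30 := fresh in
  rewrite !big_ord_recl big_ord0 /= addr0 scalemxAr lem;
  move: A00 A01 A02 A03 A10 A11 A12 A20 A21 A30;
  remember u01 as v01 eqn:Eu01; remember u02 as v02 eqn:Eu02; remember u03 as v03 eqn:Eu03;
  remember u10 as v10 eqn:Eu10; remember u11 as v11 eqn:Eu11; remember u12 as v12 eqn:Eu12;
  remember u20 as v20 eqn:Eu20; remember u21 as v21 eqn:Eu21; remember u30 as v30 eqn:Eu30;
  move=> h00 h01 h02 h03 h10 h11 h12 h20 h21 h30;
  rewrite ?(mulmxDr, mulmxN) -?scalemxAr ?(mulmxDr, mulmxN) -?scalemxAr
    ?h01 ?h02 ?h03 ?h10 ?h11 ?h12 ?h20 ?h21 ?h30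
    ?Eu01 ?Eu02 ?Eu03 ?Eu10 ?Eu11 ?Eu12 ?Eu20 ?Eu21 ?Eu30
    /u10 /u01 /u20 /u11 /u02 /u30 /u21 /u12 /u03
    /col01 /col10 /col02 /col11 /col20 /col03 /col30 /=;
  change (bump 0 0) with 1%N; change (bump 0 1) with 2%N; change (bump 0 2) with 3%N;
  eval_nat; change (2 - 0)%N with 2%N; change (2 - 1)%N with 1%N; change (2 - 2)%N with 0%N;
  change (1 - 0)%N with 1%N; change (1 - 1)%N with 0%N;
  let i := fresh in let j := fresh in
  apply/matrixP => i j; rewrite !mxE /K21 /K20 /K32 /K31 /K30 /br;
  field; rewrite ?q0 ?qq ?expqq_neq0 ?oner_neq0.

Let d2 : [#10] * [#11] * [#12] != 0. Proof. by do ?[exact: br0 | apply: mulf_neq0]. Qed.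
Let d3 : [#8] * [#9] * [#10] * [#11] * [#12] != 0.
Proof. by do ?[exact: br0 | apply: mulf_neq0]. Qed.

Lemma col00E : A *m e 0 0 = e 0 0. Proof. exact: A00. Qed.

Lemma col01E : A *m e 0 1 = \sum_(i < 2) (col01 q f1)`_i *: e i (1 - i).
Proof.
apply: (scalerI (br0 (isT : (0 < 12)%N))).
by expand_column e01E.
Qed.

Lemma col10E : A *m e 1 0 = \sum_(i < 2) (col10 q f1)`_i *: e i (1 - i).
Proof.
apply: (scalerI (br0 (isT : (0 < 12)%N))).
by expand_column e10E.
Qed.

Lemma col02E : A *m e 0 2 = \sum_(i < 3) (col02 q f1 f2)`_i *: e i (2 - i).
Proof. by apply: (scalerI d2); expand_column e02E. Qed.

Lemma col11E : A *m e 1 1 = \sum_(i < 3) (col11 q f1 f2)`_i *: e i (2 - i).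
Proof. by apply: (scalerI d2); expand_column e11E. Qed.

Lemma col20E : A *m e 2 0 = \sum_(i < 3) (col20 q f1 f2)`_i *: e i (2 - i).
Proof. by apply: (scalerI d2); expand_column e20E. Qed.

Lemma col03E : A *m e 0 3 = \sum_(i < 4) (col03 q f1 f2 f3)`_i *: e i (3 - i).
Proof. by apply: (scalerI d3); expand_column e03E. Qed.

Lemma col30E : A *m e 3 0 = \sum_(i < 4) (col30 q f1 f2 f3)`_i *: e i (3 - i).
Proof. by apply: (scalerI d3); expand_column e30E. Qed.

Lemma spectral_column x y : source x y ->
  A *m e x y = \sum_(i < (x + y).+1) column q f1 f2 f3 x y i *: e i (x + y - i).
Proof.
case: x y => [|[|[|[|x]]]] [|[|[|[|y]]]] // _; rewrite ?col01E ?col10E ?col02E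
  ?col11E ?col20E ?col03E ?col30E //.
by rewrite big_ord_recl big_ord0 addr0 scale1r col00E.
Qed.

End Ladder.

(** * Matrix elements on three factors *)

Lemma add_mxE (K : pzRingType) m p (A B : 'M[K]_(m, p)) i j :
  (A + B) i j = A i j + B i j. Proof. by rewrite mxE. Qed.
Lemma scale_mxE (K : pzRingType) m p (k : K) (A : 'M[K]_(m, p)) i j :
  (k *: A) i j = k * A i j. Proof. by rewrite mxE. Qed.

(** Matrix elements of products of operators acting on two neighbouring factors
    out of three. The vectors e3 x y z are the tensor products of basis vectors
    and ix x y z their positions; by conservation of weight, all indices that
    occur are at most 3. *)
Section Words.
Variables (F : fieldType) (N n : nat) (e3 : nat -> nat -> nat -> 'M[F]_(N, n)).
Variables (ix : nat -> nat -> nat -> 'I_N) (j0 : 'I_n).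
Hypothesis e3E : forall x y z x' y' z', (x <= 3)%N -> (y <= 3)%N -> (z <= 3)%N ->
  (x' <= 3)%N -> (y' <= 3)%N -> (z' <= 3)%N ->
  e3 x y z (ix x' y' z') j0 = [&& x == x', y == y' & z == z']%:R.

(** M acts on the first two factors through the coefficients a, and leaves the
    third factor alone; the second clause states the latter for all vectors,
    including those whose image is not computed. *)
Definition acts12 (M : 'M[F]_N) (a : nat -> nat -> nat -> F) :=
  (forall x y z, source x y ->
    M *m e3 x y z = \sum_(i < (x + y).+1) a x y i *: e3 i (x + y - i) z) /\
  (forall x y z x' y' z', (z <= 3)%N -> (z' <= 3)%N -> z != z' ->
    (M *m e3 x y z) (ix x' y' z') j0 = 0).
Definition acts23 (M : 'M[F]_N) (a : nat -> nat -> nat -> F) :=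
  (forall x y z, source y z ->
    M *m e3 x y z = \sum_(i < (y + z).+1) a y z i *: e3 x i (y + z - i)) /\
  (forall x y z x' y' z', (x <= 3)%N -> (x' <= 3)%N -> x != x' ->
    (M *m e3 x y z) (ix x' y' z') j0 = 0).

(** An operator acting on factors 1, 2 that agrees with one acting on factors
    2, 3 cannot send e_0 e_k e_0 to e_1 e_(k-1) e_0, since an operator on
    factors 2, 3 fixes the first factor. *)
Lemma word_unitary M12 M23 a a' k : acts12 M12 a -> acts23 M23 a' -> M12 = M23 ->
  (0 < k <= 3)%N -> a 0 k 1 = 0.
Proof.
move=> h12 h23 MM k3.
have := congr1 (fun M : 'M[F]_N => (M *m e3 0 k 0) (ix 1 k.-1 0) j0) MM.
rewrite (proj2 h23) // (proj1 h12); last by case/andP: k3; case: k => [|[|[|[|]]]].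
move: k3; case: k => [|[|[|[|k]]]] // _; rewrite !big_ord_recl big_ord0 addr0 /= !(add_mxE, scale_mxE).
- by rewrite !e3E //= mulr0 add0r mulr1.
- by rewrite !e3E //= !mulr0 add0r addr0 mulr1.
- by rewrite !e3E //= !mulr0 add0r !addr0 mulr1.
Qed.

Variables (A12 B12 A23 B23 : 'M[F]_N) (a b : nat -> nat -> nat -> F).
Hypotheses (hA12 : acts12 A12 a) (hB12 : acts12 B12 b).
Hypotheses (hA23 : acts23 A23 a) (hB23 : acts23 B23 b).
Hypotheses (a0 : a 0 0 0 = 1) (b0 : b 0 0 0 = 1).
Hypothesis YB : A12 *m B23 *m A12 = A23 *m B12 *m A23.

Local Ltac eval_index :=
  repeat match goal with |- context [bump ?x ?y] =>
    let v := eval compute in (bump x y) in change (bump x y) with v end;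
  repeat match goal with |- context [(?x + ?y)%N] =>
    let v := eval compute in (x + y)%N in change (x + y)%N with v end;
  repeat match goal with |- context [(?x - ?y)%N] =>
    let v := eval compute in (x - y)%N in change (x - y)%N with v end.
Local Ltac open_sum := rewrite !big_ord_recl ?big_ord0 ?addr0 /=; eval_index;
  rewrite ?a0 ?b0 ?scale1r ?mulmxDr -?scalemxAr ?add_mxE ?scale_mxE.
(* A vector inside a word is expanded; at the left end of the word only the
   terms which leave the spectator factor unchanged are. *)
Local Ltac apply_inner := repeat match goal with
  | |- context [A12 *m e3 ?x ?y ?z] => rewrite (proj1 hA12 x y z isT)
  | |- context [A23 *m e3 ?x ?y ?z] => rewrite (proj1 hA23 x y z isT)
  | |- context [B12 *m e3 ?x ?y ?z] => rewrite (proj1 hB12 x y z isT)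
  | |- context [B23 *m e3 ?x ?y ?z] => rewrite (proj1 hB23 x y z isT)
  end; open_sum.
Local Ltac apply_last := repeat match goal with
  | |- context [fun_of_matrix (A12 *m e3 ?x ?y ?z) (ix ?u ?v ?w) _] =>
    rewrite (proj2 hA12 x y z u v w isT isT isT)
  | |- context [fun_of_matrix (A23 *m e3 ?x ?y ?z) (ix ?u ?v ?w) _] =>
    rewrite (proj2 hA23 x y z u v w isT isT isT)
  end; apply_inner.

Local Ltac compute_word x y z x' y' z' :=
  have := congr1 (fun M : 'M[F]_N => (M *m e3 x y z) (ix x' y' z') j0) YB;
  rewrite -!mulmxA; do 2! apply_inner; apply_last; rewrite !e3E //=.

(** In each word the intermediate vectors are confined by weight conservation and
    by the factor that the last operator fixes, which leaves only columns of
    [source] vectors. The diagonal entry of the trivial column is 1. *)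
Lemma word_002_110 : b 0 2 2 * a 0 2 1 =
  a 0 2 2 * b 0 2 1 * a 1 0 1 + a 0 2 1 * b 0 1 1 * a 0 1 1.
Proof.
compute_word 0%N 0%N 2%N 1%N 1%N 0%N.
rewrite !(mulr0, mulr1, addr0, add0r) => E.
by apply: (etrans _ (etrans E _)); ring.
Qed.

Lemma word_003_111 : b 0 3 2 * a 0 2 1 = a 0 3 2 * b 0 2 1 * a 1 1 1
  + a 0 3 3 * b 0 3 1 * a 2 0 1 + a 0 3 1 * b 0 1 1 * a 0 2 1.
Proof.
compute_word 0%N 0%N 3%N 1%N 1%N 1%N.
rewrite !(mulr0, mulr1, addr0, add0r) => E.
by apply: (etrans _ (etrans E _)); ring.
Qed.

Lemma word_300_111 : b 3 0 1 * a 2 0 1 = a 3 0 1 * b 2 0 1 * a 1 1 1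
  + a 3 0 0 * b 3 0 2 * a 0 2 1 + a 3 0 2 * b 1 0 0 * a 2 0 1.
Proof.
compute_word 3%N 0%N 0%N 1%N 1%N 1%N.
rewrite !(mulr0, mulr1, addr0, add0r) => E.
by apply: (etrans _ (etrans (esym E) _)); ring.
Qed.
End Words.

Lemma castmx_mulmx (K : pzRingType) m m' n n' p p' (em : m = m') (en : n = n') (ep : p = p')
    (A : 'M[K]_(m, n)) (B : 'M[K]_(n, p)) :
  castmx (em, en) A *m castmx (en, ep) B = castmx (em, ep) (A *m B).
Proof. by case: m' / em; case: n' / en; case: p' / ep. Qed.

Lemma tens_suml (K : comPzRingType) I (s : seq I) m m' n n' (c : I -> K)
    (A : I -> 'M[K]_(m, m')) (B : 'M[K]_(n, n')) :
  (\sum_(i <- s) c i *: A i) *t B = \sum_(i <- s) c i *: (A i *t B).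
Proof.
apply/matrixP => i j; rewrite mxE !summxE mulr_suml.
by apply: eq_bigr => k _; rewrite !mxE mulrA.
Qed.

Lemma tens_sumr (K : comPzRingType) I (s : seq I) m m' n n' (c : I -> K)
    (A : I -> 'M[K]_(m, m')) (B : 'M[K]_(n, n')) :
  B *t (\sum_(i <- s) c i *: A i) = \sum_(i <- s) c i *: (B *t A i).
Proof.
apply/matrixP => i j; rewrite mxE !summxE mulr_sumr.
by apply: eq_bigr => k _; rewrite !mxE mulrCA.
Qed.

Lemma castmx_sum (K : pzRingType) I (s : seq I) m m' n n' (em : m = m') (en : n = n')
    (c : I -> K) (A : I -> 'M[K]_(m, n)) :
  castmx (em, en) (\sum_(i <- s) c i *: A i) = \sum_(i <- s) c i *: castmx (em, en) (A i).
Proof.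
case: m' / em; case: n' / en; rewrite castmx_id; apply: eq_bigr => i _.
by rewrite castmx_id.
Qed.

Section Legs.
Variable R : realType.
Local Notation C := (Cplx R).

Definition e3 (a b c : nat) : 'M[C]_(7 * 7 * 7, 1 * 1 * 1) := e2 R a b *t evec R c.
Definition ix3 (a b c : nat) : 'I_(7 * 7 * 7) :=
  mxtens_index (mxtens_index (dv a, dv b), dv c).
Definition ix0 : 'I_(1 * 1 * 1) := mxtens_index (mxtens_index (0, 0), 0).

Lemma dv_eq a b : (a <= 3)%N -> (b <= 3)%N -> (dv b == dv a) = (a == b).
Proof.
move=> a3 b3; rewrite -(inj_eq val_inj) /= !dvE; apply/eqP/eqP; lia.
Qed.

Lemma evecE a b : (a <= 3)%N -> (b <= 3)%N -> evec R a (dv b) 0 = (a == b)%:R.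
Proof. by move=> a3 b3; rewrite mxE eqxx andbT dv_eq. Qed.

Lemma e3E x y z x' y' z' : (x <= 3)%N -> (y <= 3)%N -> (z <= 3)%N ->
    (x' <= 3)%N -> (y' <= 3)%N -> (z' <= 3)%N ->
  e3 x y z (ix3 x' y' z') ix0 = [&& x == x', y == y' & z == z']%:R.
Proof.
move=> *; rewrite !tensmxE !evecE //.
by do 3!case: eqP => _; rewrite ?mulr0 ?mul0r ?mulr1.
Qed.

Lemma e3_assoc a b c :
  e3 a b c = castmx (mulnA 7 7 7, mulnA 1 1 1) (evec R a *t e2 R b c).
Proof. by rewrite tensmxA. Qed.

Lemma leg12_e3 (A : 'M[C]_(7 * 7)) a b c :
  leg12 A *m e3 a b c = (A *m e2 R a b) *t evec R c.
Proof. by rewrite tensmx_mul mul1mx. Qed.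

Lemma leg23_e3 (A : 'M[C]_(7 * 7)) a b c :
  leg23 A *m e3 a b c = castmx (mulnA 7 7 7, mulnA 1 1 1) (evec R a *t (A *m e2 R b c)).
Proof. by rewrite e3_assoc castmx_mulmx tensmx_mul mul1mx. Qed.

Lemma acts12_leg (A : 'M[C]_(7 * 7)) (a : nat -> nat -> nat -> C) :
    (forall x y, source x y ->
      A *m e2 R x y = \sum_(i < (x + y).+1) a x y i *: e2 R i (x + y - i)) ->
  acts12 e3 ix3 ix0 (leg12 A) a.
Proof.
move=> hA; split=> [x y z xy|x y z x' y' z' z3 z3' zz].
  by rewrite leg12_e3 hA // tens_suml.
by rewrite leg12_e3 tensmxE evecE // (negPf zz) mulr0.
Qed.

Lemma cast_ix3 x y z : cast_ord (esym (mulnA 7 7 7)) (ix3 x y z) =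
  mxtens_index (dv x, mxtens_index (dv y, dv z)).
Proof. by apply: val_inj => /=; lia. Qed.

Lemma acts23_leg (A : 'M[C]_(7 * 7)) (a : nat -> nat -> nat -> C) :
    (forall x y, source x y ->
      A *m e2 R x y = \sum_(i < (x + y).+1) a x y i *: e2 R i (x + y - i)) ->
  acts23 e3 ix3 ix0 (leg23 A) a.
Proof.
move=> hA; split=> [x y z yz|x y z x' y' z' x3 x3' xx].
  rewrite leg23_e3 hA // tens_sumr castmx_sum.
  by apply: eq_bigr => i _; rewrite e3_assoc.
rewrite leg23_e3 castmxE cast_ix3.
have -> : cast_ord (esym (mulnA 1 1 1)) ix0 = mxtens_index (0, mxtens_index (0, 0)).
  by apply: val_inj.
by rewrite tensmxE evecE // (negPf xx) mul0r.
Qed.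

Lemma leg12M (A B : 'M[C]_(7 * 7)) : leg12 A *m leg12 B = leg12 (A *m B).
Proof. by rewrite /leg12 tensmx_mul mul1mx. Qed.

Lemma leg23M (A B : 'M[C]_(7 * 7)) : leg23 A *m leg23 B = leg23 (A *m B).
Proof. by rewrite /leg23 castmx_mulmx tensmx_mul mul1mx. Qed.

Lemma tens1 m n : (1%:M : 'M[C]_m) *t (1%:M : 'M[C]_n) = 1%:M.
Proof.
apply/matrixP => i j; case: (mxtens_indexP i) => i1 i2; case: (mxtens_indexP j) => j1 j2.
rewrite tensmxE !mxE (can_eq (@mxtens_indexK m n)) xpair_eqE.
by case: eqP => _; case: eqP => _; rewrite ?mulr0 ?mul0r ?mulr1.
Qed.

Lemma leg12_1 : leg12 (1%:M : 'M[C]_(7 * 7)) = 1%:M.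
Proof. exact: tens1. Qed.

Lemma leg23_1 : leg23 (1%:M : 'M[C]_(7 * 7)) = 1%:M.
Proof. by rewrite /leg23 tens1; apply/matrixP => i j; rewrite castmxE !mxE. Qed.

End Legs.

(** * Columns of R and unitarity *)

Section ColumnVanishing.
Variables (F : fieldType) (q f1 f2 f3 : F).
Hypothesis q0 : q != 0.
Hypothesis br0 : forall k, (0 < k)%N -> br q k != 0.

(** The entry [0 k 1] is triangular in f1, f2, f3 with nonzero diagonal
    coefficients, for k = 1, 2, 3. *)
Lemma column_eq0 : (forall k, (0 < k <= 3)%N -> column q f1 f2 f3 0 k 1 = 0) ->
  [/\ f1 = 0, f2 = 0 & f3 = 0].
Proof.
move=> h; have p0 k : q^-1 ^+ k != 0 by rewrite expf_neq0 // invr_eq0.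
have V0 x : x != 0 -> x^-1 != 0 :> F by rewrite invr_eq0.
have cancel0 (c x : F) : c != 0 -> - (c * x) = 0 -> x = 0.
  by move=> c0 /eqP; rewrite oppr_eq0 mulf_eq0 (negPf c0) => /eqP.
have f10 : f1 = 0.
  apply: (@cancel0 (br q 6 / br q 12)); last by rewrite -(h 1%N isT) /column /= !mulNr.
  by do ?[exact: br0 | apply: V0 | apply: mulf_neq0].
have f20 : f2 = 0.
  apply: (@cancel0 (br q 2 * q^-1 ^+ 5 * K20 (br q))); last first.
    by rewrite -(h 2%N isT) /column /= f10 mulr0 sub0r.
  by do ?[exact: br0 | exact: p0 | apply: V0 | apply: mulf_neq0].
split=> //; apply: (@cancel0 (br q 3 * q^-1 ^+ 8 * K30 (br q))); last first.
  by rewrite -(h 3%N isT) /column /= f10 f20 !mulr0 addr0 sub0r.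
by do ?[exact: br0 | exact: p0 | apply: V0 | apply: mulf_neq0].
Qed.
End ColumnVanishing.

Section Spectral.
Variables (R : realType) (l : Cplx R).
Local Notation C := (Cplx R).
Hypothesis q_generic : generic (cexp l).
Local Notation q := (cexp l).

(** A acts on the vectors [u]dm by 1, s1, s2, s3 for d = 0, 1, 2, 3. *)
Definition spectral (A : 'M[C]_(7 * 7)) (s1 s2 s3 : C) :=
  ([/\ A *m u00 (e2 R) = u00 (e2 R), A *m u01 q (e2 R) = u01 q (e2 R),
    A *m u02 q (e2 R) = u02 q (e2 R) & A *m u03 q (e2 R) = u03 q (e2 R)] *
  [/\ A *m u10 q (e2 R) = s1 *: u10 q (e2 R), A *m u11 q (e2 R) = s1 *: u11 q (e2 R)
    & A *m u12 q (e2 R) = s1 *: u12 q (e2 R)] *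
  [/\ A *m u20 q (e2 R) = s2 *: u20 q (e2 R), A *m u21 q (e2 R) = s2 *: u21 q (e2 R)
    & A *m u30 q (e2 R) = s3 *: u30 q (e2 R)])%type.

(** An ordinal whose bound is a boolean proof, so that the coefficients r_5, r_4,
    r_3 have a uniform syntax. *)
Definition spin_ix (k : nat) (k7 : (k < 7)%N) : 'I_7 := Ordinal k7.

Lemma lowered_basis : ([/\ lowered l 6 0 (u00 (e2 R)), lowered l 6 1 (u01 q (e2 R)),
    lowered l 6 2 (u02 q (e2 R)) & lowered l 6 3 (u03 q (e2 R))] *
  [/\ lowered l 5 0 (u10 q (e2 R)), lowered l 5 1 (u11 q (e2 R))
    & lowered l 5 2 (u12 q (e2 R))] *
  [/\ lowered l 4 0 (u20 q (e2 R)), lowered l 4 1 (u21 q (e2 R))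
    & lowered l 3 0 (u30 q (e2 R))])%type.
Proof.
have q0 := q_neq0 l; have qd := qBV_neq0 q_generic.
have X := @coSp_e2 R l q_generic; have Y := @coSm_e2 R l q_generic.
have Z a b : (a <= 3)%N -> (b <= 3)%N ->
    coSz R 6 *m e2 R a b = (6 - (a + b))%N%:R *: e2 R a b.
  by move=> a3 b3; apply: coSz_e2; lia.
have b5 : br q 5 != 0 by exact: br_neq0.
have b6 : br q 6 != 0 by exact: br_neq0.
have l00 : lowered l 6 0 (u00 (e2 R)).
  by apply: lowered_highest; [apply: (Xu00 q0 qd X) | apply: (Zu00 Z)].
have l01 := @loweredS R l 6 0 _ _ _ isT b6 l00 (Yu00 q0 qd Y).
have l02 := @loweredS R l 6 1 _ _ _ isT (oner_neq0 _) l01 (Yu01 q0 qd Y).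
have l03 := @loweredS R l 6 2 _ _ _ isT b5 l02 (Yu02 q0 qd Y).
have l10 : lowered l 5 0 (u10 q (e2 R)).
  by apply: lowered_highest; [apply: (Xu10 q0 qd X) | apply: (Zu10 _ Z)].
have l11 := @loweredS R l 5 0 _ _ _ isT b5 l10 (Yu10 q0 qd Y).
have l12 := @loweredS R l 5 1 _ _ _ isT (oner_neq0 _) l11 (Yu11 q0 qd Y).
have l20 : lowered l 4 0 (u20 q (e2 R)).
  by apply: lowered_highest; [exact: (Xu20 q0 qd X) | exact: (Zu20 q0 qd Z)].
have l21 := @loweredS R l 4 0 _ _ _ isT (oner_neq0 _) l20 (Yu20 q0 qd Y).
have l30 : lowered l 3 0 (u30 q (e2 R)).
  by apply: lowered_highest; [apply: (Xu30 q0 qd X) | exact: (Zu30 q0 qd Z)].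
by [].
Qed.

Lemma Rop_spectral r x : r ord_max x = 1 ->
  spectral (Rop l r x) (r (spin_ix (isT : (5 < 7)%N)) x) (r (spin_ix (isT : (4 < 7)%N)) x)
    (r (spin_ix (isT : (3 < 7)%N)) x).
Proof.
move=> r1; have [[[l00 l01 l02 l03] [l10 l11 l12]] [l20 l21 l30]] := lowered_basis.
have act1 m w : lowered l 6 m w -> Rop l r x *m w = w.
  move=> lw; rewrite (Rop_lowered q_generic (j := ord_max) r x lw).
  by rewrite r1 scale1r.
have act k (k7 : (k < 7)%N) m w : lowered l k m w -> Rop l r x *m w = r (spin_ix k7) x *: w.
  exact: (Rop_lowered q_generic (j := spin_ix k7) r x).
exact: (And4 (act1 _ _ l00) (act1 _ _ l01) (act1 _ _ l02) (act1 _ _ l03),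
  And3 (act 5 isT _ _ l10) (act 5 isT _ _ l11) (act 5 isT _ _ l12),
  And3 (act 4 isT _ _ l20) (act 4 isT _ _ l21) (act 3 isT _ _ l30))%N.
Qed.

Lemma spectral_mul A B s1 s2 s3 t1 t2 t3 : spectral A s1 s2 s3 -> spectral B t1 t2 t3 ->
  spectral (A *m B) (s1 * t1) (s2 * t2) (s3 * t3).
Proof.
move=> [[[a00 a01 a02 a03] [a10 a11 a12]] [a20 a21 a30]].
move=> [[[b00 b01 b02 b03] [b10 b11 b12]] [b20 b21 b30]].
have mul1 w : A *m w = w -> B *m w = w -> A *m B *m w = w.
  by move=> Aw Bw; rewrite -mulmxA Bw Aw.
have muls s t w : A *m w = s *: w -> B *m w = t *: w -> A *m B *m w = (s * t) *: w.
  by move=> Aw Bw; rewrite -mulmxA Bw -scalemxAr Aw scalerA mulrC.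
exact: (And4 (mul1 _ _ a00 b00) (mul1 _ _ a01 b01) (mul1 _ _ a02 b02) (mul1 _ _ a03 b03),
  And3 (muls _ _ _ _ a10 b10) (muls _ _ _ _ a11 b11) (muls _ _ _ _ a12 b12),
  And3 (muls _ _ _ _ a20 b20) (muls _ _ _ _ a21 b21) (muls _ _ _ _ a30 b30)).
Qed.

Lemma spectral_columns A s1 s2 s3 : spectral A s1 s2 s3 -> forall x y, source x y ->
  A *m e2 R x y = \sum_(i < (x + y).+1)
    column q (s1 - 1) (s2 - 1) (s3 - 1) x y i *: e2 R i (x + y - i).
Proof.
move=> [[[a00 a01 a02 a03] [a10 a11 a12]] [a20 a21 a30]].
have e (s : C) : s = 1 + (s - 1) by rewrite addrC subrK.
rewrite (e s1) in a10 a11 a12; rewrite (e s2) in a20 a21; rewrite (e s3) in a30.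
have br0 k : (0 < k)%N -> br q k != 0 by exact: br_neq0.
exact: (spectral_column (q_neq0 l) (qBV_neq0 q_generic) br0 a00 a01 a02 a03
  a10 a11 a12 a20 a21 a30).
Qed.

End Spectral.

Section RegularConsequences.
Variables (R : realType) (l : Cplx R).
Local Notation C := (Cplx R).
Hypothesis q_generic : generic (cexp l).
Local Notation q := (cexp l).
Variable r : 'I_7 -> C -> C.
Hypothesis r_regular : @is_regular_Rmatrix R l 6 r.

Definition dev (k : nat) (k7 : (k < 7)%N) (t : C) : C := r (spin_ix k7) t - 1.
Local Notation f1 := (dev (isT : (5 < 7)%N)).
Local Notation f2 := (dev (isT : (4 < 7)%N)).
Local Notation f3 := (dev (isT : (3 < 7)%N)).
Local Notation col t := (column q (f1 t) (f2 t) (f3 t)).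

(** A leg-12 operator that equals a leg-23 operator has eigenvalue 1 throughout,
    since the eigenvalue on V_6 is 1. This serves both R(0) = 1 and the
    unitarity relation. *)
Lemma spectral_unit A B s1 s2 s3 t1 t2 t3 :
    spectral l A s1 s2 s3 -> spectral l B t1 t2 t3 -> leg12 A = leg23 B ->
  [/\ s1 = 1, s2 = 1 & s3 = 1].
Proof.
move=> /(spectral_columns q_generic)/acts12_leg hA.
move=> /(spectral_columns q_generic)/acts23_leg hB AB.
have br0 k : (0 < k)%N -> br q k != 0 by exact: br_neq0.
have [] := column_eq0 (q_neq0 l) br0
  (fun k k3 => word_unitary (@e3E R) hA hB AB k3).
by move=> /eqP + /eqP + /eqP; rewrite !subr_eq0 => /eqP -> /eqP -> /eqP ->.
Qed.

Lemma dev0 : [/\ f1 0 = 0, f2 0 = 0 & f3 0 = 0].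
Proof.
case: r_regular => _ top R0 _.
have S := Rop_spectral q_generic (nbhs_singleton top).
have [|] := spectral_unit S S.
  by rewrite R0 leg12_1 leg23_1.
by rewrite /dev => -> -> ->; rewrite !subrr.
Qed.

(** At (t, - t) the middle factor of the Yang-Baxter equation is the identity, and
    what remains is R_12(t) R_12(- t) = R_23(- t) R_23(t). *)
Lemma dev_unitary : \forall t \near (0 : C),
  [/\ (1 + f1 t) * (1 + f1 (- t)) = 1, (1 + f2 t) * (1 + f2 (- t)) = 1
    & (1 + f3 t) * (1 + f3 (- t)) = 1].
Proof.
case: r_regular => _ top R0 [[U V] [nU nV] UV].
have nN (P : C -> Prop) : (\forall t \near (0 : C), P t) -> \forall t \near (0 : C), P (- t).
  by move=> /(near0_mul (-1)); apply: filterS => t; rewrite mulN1r.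
have top' := nN _ top; have nV' := nN _ nV.
near=> t.
have t1 : r ord_max t = 1 by exact: (near top).
have t1' : r ord_max (- t) = 1 by exact: (near top').
have Ut : U t by exact: (near nU).
have Vt : V (- t) by exact: (near nV').
have := UV (t, - t) (conj Ut Vt); rewrite /yang_baxter_at /= subrr R0.
rewrite leg12_1 leg23_1 !mulmx1 leg12M leg23M => E.
have S := Rop_spectral q_generic t1; have S' := Rop_spectral q_generic t1'.
have [] := spectral_unit (spectral_mul S S') (spectral_mul S' S) E.
have dE k (k7 : (k < 7)%N) s : 1 + dev k7 s = r (spin_ix k7) s by rewrite /dev addrC subrK.
by rewrite !dE.
Unshelve. all: by end_near.
Qed.

Lemma dev_words : \forall t \near (0 : C),
  [/\ col (2 * t) 0 2 2 * col t 0 2 1 =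
      col t 0 2 2 * col (2 * t) 0 2 1 * col t 1 0 1
      + col t 0 2 1 * col (2 * t) 0 1 1 * col t 0 1 1,
    col (2 * t) 0 3 2 * col t 0 2 1 = col t 0 3 2 * col (2 * t) 0 2 1 * col t 1 1 1
      + col t 0 3 3 * col (2 * t) 0 3 1 * col t 2 0 1
      + col t 0 3 1 * col (2 * t) 0 1 1 * col t 0 2 1
  & col (2 * t) 3 0 1 * col t 2 0 1 = col t 3 0 1 * col (2 * t) 2 0 1 * col t 1 1 1
      + col t 3 0 0 * col (2 * t) 3 0 2 * col t 0 2 1
      + col t 3 0 2 * col (2 * t) 1 0 0 * col t 2 0 1].
Proof.
case: r_regular => _ top R0 [[U V] [nU nV] UV].
have top2 := near0_mul 2 top.
near=> t.
have t1 : r ord_max t = 1 by exact: (near top).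
have t2 : r ord_max (2 * t) = 1 by exact: (near top2).
have Ut : U t by exact: (near nU).
have Vt : V t by exact: (near nV).
have tt : t + t = 2 * t by ring.
have := UV (t, t) (conj Ut Vt); rewrite /yang_baxter_at /= tt => E.
have S s (s1 : r ord_max s = 1) : forall x y, source x y -> Rop l r s *m e2 R x y =
    \sum_(i < (x + y).+1) col s x y i *: e2 R i (x + y - i).
  exact: (spectral_columns q_generic (Rop_spectral q_generic s1)).
have h12 := acts12_leg (S _ t1); have h23 := acts23_leg (S _ t1).
have k12 := acts12_leg (S _ t2); have k23 := acts23_leg (S _ t2).
have c0 s : col s 0 0 0 = 1 by [].
split.
- exact: (word_002_110 (@e3E R) h12 k12 h23 k23 (c0 t) (c0 (2 * t)) E).
- exact: (word_003_111 (@e3E R) h12 k12 h23 k23 (c0 t) (c0 (2 * t)) E).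
- exact: (word_300_111 (@e3E R) h12 k12 h23 k23 (c0 t) (c0 (2 * t)) E).
Unshelve. all: by end_near.
Qed.

End RegularConsequences.

(** * The obstruction *)

Section Obstruction.
Variables (F : fieldType) (b : nat -> F) (q p x y z : F).
Local Notation d := (q - p).
Local Notation "[# n ]" := (b n) (at level 0, format "[# n ]").
Local Notation k21 := (K21 b).
Local Notation k20 := (K20 b).
Local Notation k32 := (K32 b).
Local Notation k31 := (K31 b).
Local Notation k30 := (K30 b).

(** In the names below, hxyi_0 and hxyi_y are the parts of the entry i of the
    column of e_x (x) e_y, for f1, f2, f3 = x, y, z, that are free of y and that
    multiply y; the summand 1 of the entry 1 1 1 is left out.

    The first one comes from q^6 K21 - [6] / [12] = (q - 1/q) [h022_diff], which
    supplies the second power of q - 1/q in the part of the equation for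
    e_0 e_0 e_2 that is free of y. *)
Definition h022_diff := q * [#6] ^+ 2 * [#5] / ([#10] * [#12]).
Definition obsA1 := k21 * k20 * (x - y) * ([#2] * p ^+ 5 + [#6] * d) / 2
  + [#6] / [#12] * ([#6] * d * k21 * x * k20 * q ^+ 6
    + [#2] * p ^+ 5 * k20 * (k20 * y * q ^+ 6 - x * d * h022_diff)).
Definition obsA0 := [#6] * k21 * x ^+ 2 * ([#6] / [#12]) * h022_diff.

Definition h021_0 := - [#6] * d * k21 * x.
Definition h021_y := - [#2] * p ^+ 5 * k20.
Definition h201_y := - [#2] * q ^+ 5 * k20.
Definition h111_0 := d ^+ 2 * [#6] ^+ 2 * [#5] ^+ 2 / ([#10] * [#12]) * x.
Definition h111_y := [#2] * [#5] ^+ 2 / ([#11] * [#10]).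
Definition h011 := - [#6] / [#12] * x.
Definition h033_0 := - [#4] ^+ 2 * k32 * x - k30 * z.
Definition h033_y := [#4] ^+ 2 * k31.

(** Exchanging q and 1/q together with the order of the tensor factors maps the
    column of e_0 (x) e_3 to that of e_3 (x) e_0; (s, t) is (q, 1/q) for the former
    and (1/q, q) for the latter. *)
Definition h032_0 (s t u w : F) := - [#4] * [#6] * (s ^+ 4 + s ^+ 6 - t ^+ 4) * k32 * u
  + [#3] * t ^+ 4 * k30 * w.
Definition h032_y (s t : F) := [#4] * ([#6] * s ^+ 4 - [#2] * [#5] * t ^+ 4) * k31.
Definition h031_0 (s t : F) := - [#4] * [#6] * (s ^+ 10 - 1 - s ^+ 2) * k32 * x
  - [#3] * t ^+ 8 * k30 * z.
Definition h031_y (s t : F) := [#4] * ([#6] * t ^+ 8 - [#2] * [#5]) * k31.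

(** The quotient by y of the part divisible by y in the cubic equation for
    e_0 e_0 e_3. The last four arguments are the parts of the entries 0 2 1 and
    2 0 1, which the mirror image of this equation exchanges. *)
Definition obsB1_half (s t G0 G4 G0' G4' : F) :=
  let G := G0 + y * G4 in let G' := G0' + y * G4' in
  let cG := (x * G0 + y ^+ 2 * G4) / 2 in
  let T := h111_0 + y * h111_y in
  let H0 := h032_0 s t x z in let cH0 := h032_0 s t (x ^+ 2) (z ^+ 2) / 2 in
  let H4 := h032_y s t in let I0 := h031_0 s t in let I4 := h031_y s t in let I := I0 + y * I4 in
  y * H4 * G / 2 + cH0 * G4 - H4 * cG - y * H0 * G4 / 2
  - (h033_y * I * G' + h033_0 * I4 * G' + h033_0 * I0 * G4')
  - (H4 * G * T + H0 * G4 * T + H0 * G0 * h111_y) - (I4 * h011 * G + I0 * h011 * G4).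
Definition obsB1 := obsB1_half q p h021_0 h021_y (- h021_0) h201_y
  + obsB1_half p q (- h021_0) h201_y h021_0 h021_y.

(** In the sum of the two mirror equations the part free of y is antisymmetrized
    in (q, 1/q): each of these is (E(q, 1/q) - E(1/q, q)) / (q - 1/q) for the
    corresponding term E of [h032_0] or [h031_0]. *)
Definition h032_diff_x := - [#4] * [#6] * k32 * (2 * [#4] + [#6]).
Definition h032_diff_z := - [#3] * [#4] * k30.
Definition h031_diff := - [#4] * [#6] * k32 * ([#10] - [#2]) * x + [#3] * [#8] * k30 * z.
Definition obsB0 := - [#6] * k21 * x *
  ((x ^+ 2 * h032_diff_x + z ^+ 2 * h032_diff_z) / 2 - x / 2 * (h032_diff_x * x + h032_diff_z * z)
   + (h033_0 - h011) * h031_diff - h111_0 * (h032_diff_x * x + h032_diff_z * z)).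

(** The result of eliminating y between y A1 = d^2 A0 and y B1 + d^2 B0 = 0. *)
Definition obstruction := obsA0 * obsB1 + obsA1 * obsB0.
End Obstruction.

Section ObstructionVanishes.
Variables (F : fieldType) (q x y z : F).
Local Notation p := q^-1.
Local Notation d := (q - q^-1).
Hypothesis two0 : 2 != 0 :> F.
Hypothesis q0 : q != 0.
Hypothesis d0 : d != 0.
Hypothesis x0 : x != 0.
Hypothesis br0 : forall k, (0 < k)%N -> br q k != 0.
Local Notation h := (column q x y z).
Local Notation c := (column q (x ^+ 2 / 2) (y ^+ 2 / 2) (z ^+ 2 / 2)).
Local Notation b := (br q).

Let qq : q * q - 1 != 0. Proof. exact: subV_sqr_neq0. Qed.

Let expqq_neq0 k : (0 < k)%N -> (q * q) ^+ k - 1 != 0.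
Proof. exact: expqq_neq0. Qed.

(** Both sides of the cubic equation contain x, which is nonzero and is divided
    out. *)
Lemma cubicA : c 0 2 2 * h 0 2 1 - h 0 2 2 * c 0 2 1 =
    h 0 2 2 * h 0 2 1 * (h 1 0 1 - 1) + h 0 2 1 * h 0 1 1 * h 0 1 1 ->
  y * obsA1 b q p x y = d ^+ 2 * obsA0 b q x.
Proof.
move=> E; apply: (mulfI x0); apply/eqP; rewrite -subr_eq0; apply/eqP.
transitivity (c 0 2 2 * h 0 2 1 - h 0 2 2 * c 0 2 1 -
    (h 0 2 2 * h 0 2 1 * (h 1 0 1 - 1) + h 0 2 1 * h 0 1 1 * h 0 1 1)); last first.
  by rewrite E subrr.
rewrite /column /= /obsA1 /obsA0 /h022_diff /K21 /K20 /br.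
by field; rewrite q0 qq two0 !expqq_neq0.
Qed.

Lemma cubicB : c 0 3 2 * h 0 2 1 - h 0 3 2 * c 0 2 1 =
    h 0 3 2 * h 0 2 1 * (h 1 1 1 - 1) + h 0 3 3 * h 0 3 1 * h 2 0 1
      + h 0 3 1 * h 0 1 1 * h 0 2 1 ->
  c 3 0 1 * h 2 0 1 - h 3 0 1 * c 2 0 1 =
    h 3 0 1 * h 2 0 1 * (h 1 1 1 - 1) + h 3 0 0 * h 3 0 2 * h 0 2 1
      + h 3 0 2 * h 1 0 0 * h 2 0 1 ->
  y * obsB1 b q p x y z + d ^+ 2 * obsB0 b q p x z = 0.
Proof.
move=> E E'.
transitivity (c 0 3 2 * h 0 2 1 - h 0 3 2 * c 0 2 1 -
    (h 0 3 2 * h 0 2 1 * (h 1 1 1 - 1) + h 0 3 3 * h 0 3 1 * h 2 0 1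
      + h 0 3 1 * h 0 1 1 * h 0 2 1) + (c 3 0 1 * h 2 0 1 - h 3 0 1 * c 2 0 1 -
    (h 3 0 1 * h 2 0 1 * (h 1 1 1 - 1) + h 3 0 0 * h 3 0 2 * h 0 2 1
      + h 3 0 2 * h 1 0 0 * h 2 0 1))); last by rewrite E E' !subrr addr0.
rewrite /column /= /obsB1 /obsB1_half /obsB0 /h021_0 /h021_y /h201_y /h111_0 /h111_y /h011
    /h033_0 /h033_y.
rewrite /h032_0 /h032_y /h031_0 /h031_y /h032_diff_x /h032_diff_z /h031_diff
    /K21 /K20 /K32 /K31 /K30.
rewrite /br.
by field; rewrite q0 qq two0 !expqq_neq0.
Qed.

Lemma obstruction_eq0 :
  c 0 2 2 * h 0 2 1 - h 0 2 2 * c 0 2 1 =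
    h 0 2 2 * h 0 2 1 * (h 1 0 1 - 1) + h 0 2 1 * h 0 1 1 * h 0 1 1 ->
  c 0 3 2 * h 0 2 1 - h 0 3 2 * c 0 2 1 =
    h 0 3 2 * h 0 2 1 * (h 1 1 1 - 1) + h 0 3 3 * h 0 3 1 * h 2 0 1
      + h 0 3 1 * h 0 1 1 * h 0 2 1 ->
  c 3 0 1 * h 2 0 1 - h 3 0 1 * c 2 0 1 =
    h 3 0 1 * h 2 0 1 * (h 1 1 1 - 1) + h 3 0 0 * h 3 0 2 * h 0 2 1
      + h 3 0 2 * h 1 0 0 * h 2 0 1 ->
  obstruction b q p x y z = 0.
Proof.
move=> /cubicA EA EB EB'; have EB0 := cubicB EB EB'.
apply: (mulfI (expf_neq0 2 d0)); rewrite mulr0 /obstruction mulrDr.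
rewrite mulrA -EA mulrCA; move/eqP: EB0; rewrite addr_eq0 => /eqP EB0.
by rewrite mulrAC EB0; ring.
Qed.
End ObstructionVanishes.

(** * The classical limit of the obstruction *)

Section ObstructionLimit.
Variables (K : numFieldType) (T : Type) (F : set_system T).
Context {FF : Filter F}.
Variables (b : nat -> T -> K) (q p x y z : T -> K).
Variables (b' : nat -> K) (q' p' x' y' z' : K).
Hypothesis cb : forall n, b n t @[t --> F] --> b' n.
Hypotheses (cq : q t @[t --> F] --> q') (cp : p t @[t --> F] --> p').
Hypotheses (cx : x t @[t --> F] --> x') (cy : y t @[t --> F] --> y')
  (cz : z t @[t --> F] --> z').
Hypothesis b'0 : forall n, (0 < n)%N -> b' n != 0.

Lemma cvg_exprn (u : T -> K) (u' : K) n : u t @[t --> F] --> u' -> u t ^+ n @[t --> F] --> u' ^+ n.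
Proof.
move=> uu; elim: n => [|n IHn]; first by under eq_fun do rewrite expr0; exact: cvg_cst.
by under eq_fun do rewrite exprS; rewrite exprS; apply: cvgM.
Qed.

Local Ltac limit := repeat lazymatch goal with
  | |- cvg_to (nbhs (fmap (fun t => b ?n t) _)) _ => exact: cb
  | |- cvg_to (nbhs (fmap (fun t => _ + _) _)) _ => apply: cvgD
  | |- cvg_to (nbhs (fmap (fun t => - _) _)) _ => apply: cvgN
  | |- cvg_to (nbhs (fmap (fun t => _ * _) _)) _ => apply: cvgM
  | |- cvg_to (nbhs (fmap (fun t => _ ^+ _) _)) _ => apply: cvg_exprn
  | |- cvg_to (nbhs (fmap (fun t => _^-1) _)) _ => apply: cvgV
  | H : cvg_to (nbhs (fmap ?f _)) _ |- cvg_to (nbhs (fmap ?f _)) _ => exact: H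
  | |- cvg_to _ _ => exact: cvg_cst
  | |- is_true (_ != 0) => do ?[exact: b'0 | apply: mulf_neq0 | rewrite pnatr_eq0]
  end.

Lemma obstruction_cvg :
  obstruction (b ^~ t) (q t) (p t) (x t) (y t) (z t) @[t --> F] -->
  obstruction b' q' p' x' y' z'.
Proof.
have c21 : K21 (b ^~ t) @[t --> F] --> K21 b' by rewrite /K21; limit.
have c20 : K20 (b ^~ t) @[t --> F] --> K20 b' by rewrite /K20; limit.
have c32 : K32 (b ^~ t) @[t --> F] --> K32 b' by rewrite /K32; limit.
have c31 : K31 (b ^~ t) @[t --> F] --> K31 b' by rewrite /K31; limit.
have c30 : K30 (b ^~ t) @[t --> F] --> K30 b' by rewrite /K30; limit.
have cwQ : h022_diff (b ^~ t) (q t) @[t --> F] --> h022_diff b' q' by rewrite /h022_diff; limit.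
have cA1 : obsA1 (b ^~ t) (q t) (p t) (x t) (y t) @[t --> F] --> obsA1 b' q' p' x' y'.
  by rewrite /obsA1; limit.
have cA0 : obsA0 (b ^~ t) (q t) (x t) @[t --> F] --> obsA0 b' q' x' by rewrite /obsA0; limit.
have cG0 : h021_0 (b ^~ t) (q t) (p t) (x t) @[t --> F] --> h021_0 b' q' p' x'
  by rewrite /h021_0; limit.
have cG4 : h021_y (b ^~ t) (p t) @[t --> F] --> h021_y b' p' by rewrite /h021_y; limit.
have cG4' : h201_y (b ^~ t) (q t) @[t --> F] --> h201_y b' q' by rewrite /h201_y; limit.
have cT0 : h111_0 (b ^~ t) (q t) (p t) (x t) @[t --> F] --> h111_0 b' q' p' x'
  by rewrite /h111_0; limit.
have cT4 : h111_y (b ^~ t) @[t --> F] --> h111_y b' by rewrite /h111_y; limit.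
have cm : h011 (b ^~ t) (x t) @[t --> F] --> h011 b' x' by rewrite /h011; limit.
have cL0 : h033_0 (b ^~ t) (x t) (z t) @[t --> F] --> h033_0 b' x' z' by rewrite /h033_0; limit.
have cL4 : h033_y (b ^~ t) @[t --> F] --> h033_y b' by rewrite /h033_y; limit.
have cH5 : h032_diff_x (b ^~ t) @[t --> F] --> h032_diff_x b' by rewrite /h032_diff_x; limit.
have cH3 : h032_diff_z (b ^~ t) @[t --> F] --> h032_diff_z b' by rewrite /h032_diff_z; limit.
have cI : h031_diff (b ^~ t) (x t) (z t) @[t --> F] --> h031_diff b' x' z' by rewrite /h031_diff; limit.
have cB0 : obsB0 (b ^~ t) (q t) (p t) (x t) (z t) @[t --> F] --> obsB0 b' q' p' x' z'.
  by rewrite /obsB0; limit.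
have cB1 (s r g k u v : T -> K) (s' r' g' k' u' v' : K) :
    s t @[t --> F] --> s' -> r t @[t --> F] --> r' -> g t @[t --> F] --> g' ->
    k t @[t --> F] --> k' -> u t @[t --> F] --> u' -> v t @[t --> F] --> v' ->
    obsB1_half (b ^~ t) (q t) (p t) (x t) (y t) (z t) (s t) (r t) (g t) (k t) (u t) (v t)
      @[t --> F] -->
    obsB1_half b' q' p' x' y' z' s' r' g' k' u' v'.
  move=> cs cr cg ck cu cv.
  have cH0 (a c : T -> K) (a' c' : K) : a t @[t --> F] --> a' -> c t @[t --> F] --> c' ->
      h032_0 (b ^~ t) (s t) (r t) (a t) (c t) @[t --> F] --> h032_0 b' s' r' a' c'.
    by move=> ca cc; rewrite /h032_0; limit.
  have cH01 := cH0 _ _ _ _ cx cz.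
  have cH02 := cH0 _ _ _ _ (cvg_exprn (n := 2) cx) (cvg_exprn (n := 2) cz).
  have cH4 : h032_y (b ^~ t) (s t) (r t) @[t --> F] --> h032_y b' s' r' by rewrite /h032_y; limit.
  have cI0 : h031_0 (b ^~ t) (x t) (z t) (s t) (r t) @[t --> F] --> h031_0 b' x' z' s' r'.
    by rewrite /h031_0; limit.
  have cI4 : h031_y (b ^~ t) (s t) (r t) @[t --> F] --> h031_y b' s' r' by rewrite /h031_y; limit.
  by rewrite /obsB1_half; limit.
have cB1' : obsB1 (b ^~ t) (q t) (p t) (x t) (y t) (z t) @[t --> F] -->
    obsB1 b' q' p' x' y' z'.
  by apply: cvgD; apply: cB1; limit.
by rewrite /obstruction; limit.
Qed.
End ObstructionLimit.

(** The values 2, 0, 1/2 are the slopes of the classical r_5, r_4, r_3. *)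
Lemma obstruction_classical (K : numFieldType) :
  obstruction (fun n => n%:R) 1 1 2 0 (2 / 4) != 0 :> K.
Proof.
have -> : obstruction (fun n => n%:R) 1 1 2 0 (2 / 4) = - 27 / 11 :> K.
  rewrite /obstruction /obsA0 /obsA1 /obsB1 /obsB1_half /obsB0 /h021_0 /h021_y /h201_y /h111_0 /h111_y /h011
    /h033_0 /h033_y.
  rewrite /h032_0 /h032_y /h031_0 /h031_y /h032_diff_x /h032_diff_z /h031_diff
    /h022_diff /K21 /K20 /K32 /K31 /K30.
  by field.
by rewrite mulf_neq0 ?oppr_eq0 ?invr_eq0 ?pnatr_eq0.
Qed.

(** * The cubic equations of a regular R-matrix *)

Section ColumnJets.
Variables (F : fieldType) (q : F).

Lemma column0 x y i : source x y -> column q 0 0 0 x y i = (i == x)%:R.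
Proof.
case: x y i => [|[|[|[|x]]]] [|[|[|[|y]]]] [|[|[|[|i]]]] // _;
  by rewrite /column /= ?nth_nil ?mulr0 ?subr0 ?addr0.
Qed.

(** The columns are affine in (f1, f2, f3); hence their jets are obtained by
    inserting the jets of r_5, r_4, r_3. *)
Lemma column_linear f1 f2 f3 x y i : source x y ->
  column q f1 f2 f3 x y i = column q 0 0 0 x y i
    + (f1 * (column q 1 0 0 x y i - column q 0 0 0 x y i)
    + f2 * (column q 0 1 0 x y i - column q 0 0 0 x y i)
    + f3 * (column q 0 0 1 x y i - column q 0 0 0 x y i)).
Proof.
case: x y i => [|[|[|[|x]]]] [|[|[|[|y]]]] [|[|[|[|i]]]] // _;
  by rewrite /column /= ?nth_nil; ring.
Qed.
End ColumnJets.

Section Cubic.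
Variables (R : realType) (l : Cplx R).
Local Notation C := (Cplx R).
Hypothesis q_generic : generic (cexp l).
Local Notation q := (cexp l).
Variable r : 'I_7 -> C -> C.
Hypothesis r_regular : @is_regular_Rmatrix R l 6 r.
Local Notation r5 := (r (spin_ix (isT : (5 < 7)%N))).
Local Notation r4 := (r (spin_ix (isT : (4 < 7)%N))).
Local Notation r3 := (r (spin_ix (isT : (3 < 7)%N))).
Local Notation f1 := (dev r (isT : (5 < 7)%N)).
Local Notation f2 := (dev r (isT : (4 < 7)%N)).
Local Notation f3 := (dev r (isT : (3 < 7)%N)).
Local Notation col t := (column q (f1 t) (f2 t) (f3 t)).
Local Notation x := (slope r5).
Local Notation y := (slope r4).
Local Notation z := (slope r3).
Local Notation h := (column q x y z).
Local Notation c := (column q (x ^+ 2 / 2) (y ^+ 2 / 2) (z ^+ 2 / 2)).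

Lemma jet_dev : [/\ jet f1 x (x ^+ 2 / 2), jet f2 y (y ^+ 2 / 2) & jet f3 z (z ^+ 2 / 2)].
Proof.
have [f10 f20 f30] := dev0 q_generic r_regular.
have un := dev_unitary q_generic r_regular.
case: r_regular => an _ _ _.
have J1 (k : nat) (k7 : (k < 7)%N) : dev r k7 0 = 0 ->
    (\forall t \near (0 : C), (1 + dev r k7 t) * (1 + dev r k7 (- t)) = 1) ->
    jet (dev r k7) (slope (r (spin_ix k7))) (slope (r (spin_ix k7)) ^+ 2 / 2).
  move=> /eqP; rewrite subr_eq0 => /eqP r0 un1.
  have [v jv] := analytic_jet (an (spin_ix k7)).
  have jv' : jet (dev r k7) (slope (r (spin_ix k7))) v.
    by rewrite r0 in jv; exact: jv.
  by rewrite -(jet_unitary jv' un1).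
by split; apply: J1 => //; apply: filterS un => t [].
Qed.

Lemma jet_column a b i : source a b ->
  jet (fun t => col t a b i - (i == a)%:R) (h a b i - (i == a)%:R) (c a b i - (i == a)%:R).
Proof.
move=> ab; have [J1 J2 J3] := jet_dev.
rewrite -(column0 q i ab).
have E u v w : column q u v w a b i - column q 0 0 0 a b i =
    (column q 1 0 0 a b i - column q 0 0 0 a b i) * u
    + (column q 0 1 0 a b i - column q 0 0 0 a b i) * v
    + (column q 0 0 1 a b i - column q 0 0 0 a b i) * w.
  by rewrite (column_linear q u v w i ab) addrC addKr ![u * _]mulrC ![v * _]mulrC ![w * _]mulrC.
rewrite (E x y z) (E (x ^+ 2 / 2) (y ^+ 2 / 2) (z ^+ 2 / 2)).
rewrite (funext (fun t => E (f1 t) (f2 t) (f3 t))).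
by apply: jetD; [apply: jetD|]; apply: jetZ.
Qed.

Lemma cubic_equations :
  [/\ c 0 2 2 * h 0 2 1 - h 0 2 2 * c 0 2 1 =
      h 0 2 2 * h 0 2 1 * (h 1 0 1 - 1) + h 0 2 1 * h 0 1 1 * h 0 1 1,
    c 0 3 2 * h 0 2 1 - h 0 3 2 * c 0 2 1 =
      h 0 3 2 * h 0 2 1 * (h 1 1 1 - 1) + h 0 3 3 * h 0 3 1 * h 2 0 1
      + h 0 3 1 * h 0 1 1 * h 0 2 1
  & c 3 0 1 * h 2 0 1 - h 3 0 1 * c 2 0 1 =
      h 3 0 1 * h 2 0 1 * (h 1 1 1 - 1) + h 3 0 0 * h 3 0 2 * h 0 2 1
      + h 3 0 2 * h 1 0 0 * h 2 0 1].
Proof.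
have off a b i : source a b -> (i == a) = false ->
    jet (fun t => col t a b i) (h a b i) (c a b i).
  move=> ab ia; have := jet_column i ab; rewrite ia.
  by under eq_fun do rewrite subr0; rewrite !subr0.
have diag a b : source a b -> jet (fun t => col t a b a - 1) (h a b a - 1) (c a b a - 1).
  by move=> ab; have := jet_column a ab; rewrite eqxx.
have j0 : jet (fun=> 0 : C) 0 0.
  exists (fun=> 0); split; last exact: cvg_cst.
  by near=> t; rewrite mulr0 addr0 mulr0.
have W := dev_words q_generic r_regular.
have zero3 : 0 * 0 * 0 = 0 :> C by rewrite !mul0r.
split.
- have W1 : \forall t \near at0, col (2 * t) 0 2 2 * col t 0 2 1 =
      col t 0 2 2 * col (2 * t) 0 2 1 * col t 1 0 1
      + col t 0 2 1 * col (2 * t) 0 1 1 * col t 0 1 1 + 0 * 0 * 0.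
    apply: filterS W => t [e _ _].
    exact: (etrans e (esym (etrans (congr1 (+%R _) zero3) (addr0 _)))).
  have e := jet_cubic (off 0 2 2 isT erefl)%N (off 0 2 1 isT erefl)%N (diag 1 0 isT)%N
    (off 0 2 1 isT erefl)%N (off 0 1 1 isT erefl)%N (off 0 1 1 isT erefl)%N j0 j0 j0 W1.
  exact: (etrans e (etrans (congr1 (+%R _) zero3) (addr0 _))).
- apply: (jet_cubic (off 0 3 2 isT erefl) (off 0 2 1 isT erefl) (diag 1 1 isT)
    (off 0 3 3 isT erefl) (off 0 3 1 isT erefl) (off 2 0 1 isT erefl)
    (off 0 3 1 isT erefl) (off 0 1 1 isT erefl) (off 0 2 1 isT erefl))%N.
  by apply: filterS W => t [_ e _]; exact: e.
- apply: (jet_cubic (off 3 0 1 isT erefl) (off 2 0 1 isT erefl) (diag 1 1 isT)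
    (off 3 0 0 isT erefl) (off 3 0 2 isT erefl) (off 0 2 1 isT erefl)
    (off 3 0 2 isT erefl) (off 1 0 0 isT erefl) (off 2 0 1 isT erefl))%N.
  by apply: filterS W => t [_ _ e]; exact: e.
Unshelve. all: by end_near.
Qed.

Lemma regular_obstruction : x != 0 -> obstruction (br q) q q^-1 x y z = 0.
Proof.
move=> x0; have [EA EB EB'] := cubic_equations.
have br0 k : (0 < k)%N -> br q k != 0 by exact: br_neq0.
apply: (obstruction_eq0 _ (q_neq0 l) (qBV_neq0 q_generic) x0 br0 EA EB EB').
by rewrite pnatr_eq0.
Qed.
End Cubic.

(** * Absence of a regular counterpart *)

Lemma brS (F : fieldType) (q : F) n : q != 0 -> q - q^-1 != 0 ->
  br q n.+1 = q * br q n + q^-1 ^+ n.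
Proof.
move=> q0 qd; rewrite /br !exprS exprVn; have qn0 : q ^+ n != 0 by rewrite expf_neq0.
by field; rewrite q0 qn0 subV_sqr_neq0.
Qed.

(** The recursion [brS] extends the q-numbers continuously to q = 1, where their
    definition divides by 0. *)
Lemma br_cvg (R : realType) (Q : set (Cplx R)) n :
    (forall q, Q q -> generic q) ->
  br q n @[q --> within Q (nbhs (1 : Cplx R))] --> (n%:R : Cplx R).
Proof.
move=> Qg; set F := within _ _.
have cq : q @[q --> F] --> (1 : Cplx R) by exact: cvg_within.
elim: n => [|n IHn].
  rewrite mulr0n (_ : (fun q : Cplx R => br q 0) = fun=> 0); first exact: cvg_cst.
  by apply/funext => q; rewrite /br !expr0 invr1 subrr mul0r.
have cp : q^-1 ^+ n @[q --> F] --> (1 : Cplx R).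
  have : q^-1 ^+ n @[q --> F] --> ((1 : Cplx R)^-1 ^+ n : Cplx R).
    by apply: cvg_exprn; apply: cvgV; [exact: oner_neq0 | exact: cq].
  by rewrite invr1 expr1n.
have : q * br q n + q^-1 ^+ n @[q --> F] --> (1 * n%:R + 1 : Cplx R).
  by apply: cvgD; [apply: cvgM; [exact: cq | exact: IHn] | exact: cp].
rewrite mul1r natr1; apply: cvg_trans; apply: near_eq_cvg.
have Qn : \forall q \near F, Q q by exact: withinT.
near=> q.
have [q0 qX] : generic q by apply: Qg; exact: (near Qn).
rewrite brS //; apply: contraNneq (qX 2%N isT) => /eqP.
by rewrite subr_eq0 => /eqP qq; rewrite expr2 {1}qq mulVf.
Unshelve. all: by end_near.
Qed.

Theorem mainTheorem4 (R : realType) (logq : Cplx R -> Cplx R)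
    (logqP : forall q : Cplx R, q != 0 -> cexp (logq q) = q) :
  ~ exists (Q : set (Cplx R)) (r : Cplx R -> 'I_7 -> Cplx R -> Cplx R),
      [/\ forall q : Cplx R, Q q -> generic q,
          limit_point Q (1 : Cplx R),
          forall q : Cplx R, Q q -> @is_regular_Rmatrix R (logq q) 6 (r q)
        & forall j : 'I_7,
            cvg_analytic_near0 (within Q (nbhs (1 : Cplx R)))
              (fun q : Cplx R => r q j) (@r_spin3 R j)].
Proof.
move=> [Q [r [Qg Q1 Qr rcvg]]].
set F := within Q (nbhs (1 : Cplx R)).
pose s (k : nat) (k7 : (k < 7)%N) q := slope (r q (spin_ix k7)).
have c1 : 0 < 1 :> Cplx R by exact: ltr01.
have c4 : 0 < 4 :> Cplx R by rewrite ltr0n.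
have lim k (k7 : (k < 7)%N) g v : @r_spin3 R (spin_ix k7) = g -> analytic_near0 g ->
    slope g = v -> s k k7 q @[q --> F] --> v.
  by move=> <- ag <-; exact: slope_cvg (rcvg (spin_ix k7)) ag.
have cx : s 5%N isT q @[q --> F] --> (2 : Cplx R).
  apply: (lim 5%N isT (fun x => (1 + x) / (1 - x)) 2 erefl); first exact: moebius_analytic.
  exact: etrans (moebius_slope c1) (divr1 2).
have cy : s 4%N isT q @[q --> F] --> (0 : Cplx R).
  exact: (lim 4%N isT (fun=> 1) 0 erefl (one_analytic R) (one_slope R)).
have cz : s 3%N isT q @[q --> F] --> (2 / 4 : Cplx R).
  exact: (lim 3%N isT (fun x => (4 + x) / (4 - x)) (2 / 4) erefl (moebius_analytic c4)
    (moebius_slope c4)).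
have cq : q @[q --> F] --> (1 : Cplx R) by exact: cvg_within.
have cp : q^-1 @[q --> F] --> (1 : Cplx R).
  have : q^-1 @[q --> F] --> ((1 : Cplx R)^-1 : Cplx R).
    by apply: cvgV; [exact: oner_neq0 | exact: cq].
  by rewrite invr1.
have n0 n : (0 < n)%N -> n%:R != 0 :> Cplx R by rewrite pnatr_eq0 -lt0n.
have nL := cvgr_neq0 _ (obstruction_cvg (fun n => br_cvg (n := n) Qg) cq cp cx cy cz n0)
  (obstruction_classical (Cplx R)).
have nx := cvgr_neq0 _ cx (n0 2%N isT).
have [q [q1 Qq Dq]] := Q1 _ (filterI (nL _ _) (nx _)).
case: (Dq Qq) => Lq xq.
have [q0 _] := Qg q Qq.
have lq := logqP q q0.
have := @regular_obstruction R (logq q) _ (r q) (Qr q Qq) xq.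
rewrite lq => /(_ (Qg q Qq)) o0.
by move: Lq; rewrite /= o0 eqxx.
Qed.
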